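(* Let $X$ be the Wiener process normalized by $E[\exp(i\xi X(\tau))]=\exp(-\tau\xi^2)$, $X(0)=0$. Then the following hold. (A) For every fixed $a>0$, $$p_2(t,a)=e^{-t/\lambda_2(a)}g_2(0,a)\int_{-a}^{a}h_2(x,a)\,dx\,[1+o(1)],\qquad t\to\infty.$$ (B) For $a>0$, $s>0$, $t>0$, $x\in(-1,1)$, $$\psi_2(ax,s,a)=a\,\psi_2(x,sa^2,1),\qquad p_2(t,a)=p_2\Big(\frac{t}{a^2},1\Big).$$ (C) Let $a(t)>0$ be such that $t/a^2(t)\to\infty$ as $t\to\infty$. Then, as $t\to\infty$, $$p_2(t,a(t))=e^{-t/[a^2(t)\lambda_2]}g_2(0)\int_{-1}^{1}h_2(x)\,dx\,[1+o(1)],$$ $$\lim_{t\to\infty} p_2(t,a(t))=0,\qquad \lim_{t\to\infty} P\Big[\sup_{0\le\tau\le t}|X(\tau)|>a(t)\Big]=1.$$ (D) Let $a(t)>0$ be such that $t/[a(t)]^2\to 0$ as $t\to\infty$. Then $$\lim_{t\to\infty}p_2(t,a(t))=1,\qquad \lim_{t\to\infty}P\Big[\sup_{0\le\tau\le t}|X(\tau)|>a(t)\Big]=0.$$ (E) Let $a(t)>0$ be such that $t/[a(t)]^2\to T$ as $t\to\infty$, where $0<T<\infty$. Then $$\lim_{t\to\infty}p_2(t,a(t))=p_2(T).$$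
   Context: For $t,a>0$, $p_2(t,a)=P(\sup_{0\le\tau\le t}|X(\tau)|<a)$, and $p_2(t)=p_2(t,1)$. For $a>0$ the operator $B_2$ acts in $L^2(-a,a)$ by $B_2f(x)=\int_{-a}^a\Phi_2(x,y,a)f(y)\,dy$, where $\Phi_2$ is the Green's function of $-y''=f$ on $[-a,a]$ with boundary conditions $y(-a)=y(a)=0$: $$\Phi_2(x,t,a)=\frac{1}{2a}(t+a)(a-x)\ \text{ for } -a\le t\le x,\qquad \Phi_2(x,t,a)=\frac{1}{2a}(a-t)(a+x)\ \text{ for } x\le t\le a.$$ The function $\psi_2$ is defined by $\psi_2(x,s,a)=(I+sB_2^\star)^{-1}\Phi_2(0,x,a)$, i.e. $(I+sB_2^\star)^{-1}$ applied to the function $x\mapsto\Phi_2(0,x,a)$. $\lambda_2(a)$ is the largest eigenvalue of $B_2$; $g_2(x,a)$ and $h_2(x,a)$ are the corresponding non-negative eigenfunctions of $B_2$ and of its adjoint $B_2^\star$, normalized by $(g_2,h_2)=\int_{-a}^{a}g_2(x,a)h_2(x,a)\,dx=1$. For $a=1$ write $\lambda_2=\lambda_2(1)$, $g_2(x)=g_2(x,1)$, $h_2(x)=h_2(x,1)$. *)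

(* Defs.v *)
From HB Require Import structures.
From mathcomp Require Import all_boot all_order all_algebra.
From mathcomp Require Import complex.
From mathcomp Require Import all_classical all_reals all_analysis.
From mathcomp Require Import measurable_realfun ring lra.

Set Implicit Arguments.
Unset Strict Implicit.
Unset Printing Implicit Defensive.
Import Order.TTheory GRing.Theory Num.Theory.
Import numFieldNormedType.Exports.

Local Open Scope classical_set_scope.
Local Open Scope ring_scope.
Local Open Scope complex_scope.

Section WienerProcess.
Context (d : measure_display) (T : measurableType d) (R : realType)
        (P : probability T R).

Definition mutually_independent (I : finType) (Y : I -> T -> R) : Prop :=
  forall (B : I -> set R), (forall i, measurable (B i)) ->
  forall J : {set I},
    fine (P [set w | forall i, i \in J -> B i (Y i w)]) =
    \prod_(i in J) fine (P (Y i @^-1` B i)).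

Definition expi (y : R) : R[i] := cos y +i* sin y.

(* The expectation of a complex random variable is taken componentwise. *)
Definition characteristic_function (Y : T -> R) (xi : R) : R[i] :=
  fine ('E_P[fun w => complex.Re (expi (xi * Y w))]) +i*
  fine ('E_P[fun w => complex.Im (expi (xi * Y w))]).

(* Only the times tau >= 0 matter.  The variance of X tau is 2 * tau,
   not tau. *)
Record wiener_process (X : R -> T -> R) : Prop := WienerProcess {
  wiener_measurable : forall tau, 0 <= tau -> measurable_fun setT (X tau) ;
  wiener_start : {ae P, forall w, X 0 w = 0} ;
  wiener_continuous : forall w, {within `[0, +oo[, continuous (X ^~ w)} ;
  wiener_independent : forall (n : nat) (t : nat -> R),
    0 <= t 0%N -> (forall i, (i < n)%N -> t i <= t i.+1) ->
    mutually_independent (fun (i : 'I_n) w => X (t i.+1) w - X (t i) w) ;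
  wiener_stationary : forall s t, 0 <= s -> s <= t ->
    forall B : set R, measurable B ->
      P ((fun w => X t w - X s w) @^-1` B) = P (X (t - s) @^-1` B) ;
  wiener_charfun : forall tau xi, 0 <= tau ->
    characteristic_function (X tau) xi = (expR (- (tau * xi ^+ 2)))%:C }.

(* The supremum is taken in \bar R, so that it needs no boundedness proof. *)
Definition running_sup (X : R -> T -> R) (t : R) (w : T) : \bar R :=
  ereal_sup [set (`|X tau w|)%:E | tau in `[0, t]].

Definition p2 (X : R -> T -> R) (t a : R) : R :=
  fine (P [set w | (running_sup X t w < a%:E)%E]).

Definition prob_sup_gt (X : R -> T -> R) (t a : R) : R :=
  fine (P [set w | (a%:E < running_sup X t w)%E]).

End WienerProcess.

Section GreenOperator.
Context {R : realType}.
Implicit Types (a s l : R) (f g u : R -> R) (A : (R -> R) -> R -> R).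

Notation mu := (@lebesgue_measure R).

(* Real L^2(-a, a), as functions on the line extended by 0 off `]-a, a[. *)
Definition L2 a f : Prop := f \_ `]- a, a[ \in Lfun mu 2%:E.

Definition inner a f g : R := \int[mu]_(x in `]- a, a[) (f x * g x).

Definition Phi2 (x t a : R) : R :=
  if t <= x then (2 * a)^-1 * (t + a) * (a - x)
  else (2 * a)^-1 * (a - t) * (a + x).

Definition B2 a f : R -> R :=
  fun x => \int[mu]_(y in `]- a, a[) (Phi2 x y a * f y).

(* The L^2 adjoint of B2 a, see [inner_B2]. *)
Definition B2adj a f : R -> R :=
  fun x => \int[mu]_(y in `]- a, a[) (Phi2 y x a * f y).

Lemma L2_patch_integrable a f : L2 a f ->
  mu.-integrable setT (EFin \o f \_ `]- a, a[).
Proof.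
move=> Lf; have if2 := Lfun2_integrable_sqr Lf.
have mf : measurable_fun setT (f \_ `]- a, a[).
  by move: Lf; rewrite /L2 inE => /andP[/[!inE]].
have i1 : mu.-integrable setT (EFin \o (\1_(`]- a, a[) : R -> R)).
  exact: integrable_indic_itv.
apply: (le_integrable measurableT _ _ (integrableD measurableT if2 i1)).
  exact/measurable_EFinP.
move=> x _ /=; rewrite lee_fin patchE indicE.
rewrite [leRHS]ger0_norm ?addr_ge0 ?sqr_ge0 //.
case: (x \in _) => /=; rewrite ?normr0 ?expr0n ?addr0 //.
by rewrite ler_norml; apply/andP; split; nra.
Qed.

Lemma Rintegral_Fubini (F : R * R -> R) :
  (mu \x mu)%E.-integrable setT (EFin \o F) ->
  (forall x, mu.-integrable setT (fun y => (F (x, y))%:E)) ->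
  (forall y, mu.-integrable setT (fun x => (F (x, y))%:E)) ->
  \int[mu]_x (\int[mu]_y F (x, y)) = \int[mu]_y (\int[mu]_x F (x, y)).
Proof.
move=> iF i1 i2; congr fine.
under eq_integral => x _ do
  rewrite fineK ?(integrable_fin_num measurableT (i1 x)) //.
rewrite (Fubini iF); apply: eq_integral => y _.
by rewrite fineK // (integrable_fin_num measurableT (i2 y)).
Qed.

Lemma measurable_Phi2 a : measurable_fun setT (fun z : R * R => Phi2 z.1 z.2 a).
Proof.
apply: measurable_fun_ifT; first exact: measurable_fun_ler.
- apply: measurable_funM.
    apply: measurable_funM; first by [].
    by apply: measurable_funD; [exact: measurable_snd | by []].
  by apply: measurable_funB; [by [] | exact: measurable_fst].
- apply: measurable_funM.
    apply: measurable_funM; first by [].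
    by apply: measurable_funB; [by [] | exact: measurable_snd].
  by apply: measurable_funD; [by [] | exact: measurable_fst].
Qed.
Lemma Phi2_bound a (x t : R) : 0 < a -> x \in `]- a, a[ -> t \in `]- a, a[ ->
  `|Phi2 x t a| <= 2 * a.
Proof.
rewrite !in_itv /= => a0 /andP[x1 x2] /andP[t1 t2].
have a2 : 0 < (2 * a)^-1 by rewrite invr_gt0; lra.
have K (u v : R) : 0 <= u <= 2 * a -> 0 <= v <= 2 * a ->
    `|(2 * a)^-1 * u * v| <= 2 * a.
  move=> /andP[u0 u1] /andP[v0 v1].
  rewrite ger0_norm; last by rewrite !mulr_ge0 // ltW.
  rewrite -mulrA ler_pdivrMl; last by lra.
  by apply: ler_pM.
by rewrite /Phi2; case: ifP => _; apply: K; apply/andP; split; lra.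
Qed.

Lemma inner_B2 a f g : 0 < a -> L2 a f -> L2 a g ->
  inner a (B2 a f) g = inner a f (B2adj a g).
Proof.
move=> a0 Lf Lg; set D : set R := `]- a, a[%classic.
set fD := f \_ D; set gD := g \_ D.
have if_ : mu.-integrable setT (EFin \o fD) := L2_patch_integrable Lf.
have ig : mu.-integrable setT (EFin \o gD) := L2_patch_integrable Lg.
have mf : measurable_fun setT fD by case/integrableP: if_ => /measurable_EFinP.
have mg : measurable_fun setT gD by case/integrableP: ig => /measurable_EFinP.
pose F (z : R * R) := Phi2 z.1 z.2 a * fD z.2 * gD z.1.
have mF : measurable_fun setT F.
  apply: measurable_funM; first apply: measurable_funM.
  - exact: measurable_Phi2.
  - by apply: measurableT_comp => //.
  - by apply: measurableT_comp => //.
have bF x y : `|F (x, y)| <= `|2 * a * fD y * gD x|.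
  rewrite /F /fD /gD /= !patchE.
  case: ifPn => [|_]; last by rewrite !(mulr0, mul0r).
  rewrite inE => yD; case: ifPn => [|_]; last by rewrite !mulr0.
  rewrite inE => xD; rewrite !normrM !ler_wpM2r //.
  by rewrite -normrM; apply: le_trans (ler_norm _); exact: Phi2_bound.
have i1 x : mu.-integrable setT (fun y => (F (x, y))%:E).
  have := integrableZl measurableT (2 * a * gD x) if_.
  apply: le_integrable => //.
    by apply/measurable_EFinP; apply: (measurableT_comp mF);
      exact: pair1_measurable.
  by move=> y _ /=; rewrite lee_fin (le_trans (bF x y)) // mulrAC.
have i2 y : mu.-integrable setT (fun x => (F (x, y))%:E).
  have := integrableZl measurableT (2 * a * fD y) ig.
  apply: le_integrable => //.
    by apply/measurable_EFinP; apply: (measurableT_comp mF);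
      exact: pair2_measurable.
  by move=> x _ /=; rewrite lee_fin (le_trans (bF x y)).
have iF : (mu \x mu)%E.-integrable setT (EFin \o F).
  apply/integrable12ltyP; first exact/measurable_EFinP.
  pose c := (\int[mu]_y `|fD y|%:E)%E.
  have cfin : c \is a fin_num.
    by rewrite ge0_fin_numE ?integral_ge0 //; case/integrableP: if_.
  apply: (@le_lt_trans _ _ (\int[mu]_x ((2 * a * fine c)%:E * `|(gD x)%:E|))%E).
    apply: ge0_le_integral => //.
    - by move=> x _; exact: integral_ge0.
    - apply: (@measurable_fun_fubini_tonelli_F _ _ _ _ _ mu
        (fun z => `|(F z)%:E|%E)) => //.
      by apply: measurableT_comp => //; exact/measurable_EFinP.
    - apply: measurable_funeM; apply: measurableT_comp => //.
      exact/measurable_EFinP.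
    - move=> x _; rewrite [leRHS](_ : _ = \int[mu]_y
          ((2 * a * `|gD x|)%:E * `|(fD y)%:E|))%E.
        apply: ge0_le_integral => //.
        + apply/measurableT_comp => //; apply/measurable_EFinP.
          apply: (measurableT_comp mF); exact: pair1_measurable.
        + apply: measurable_funeM; apply: measurableT_comp => //.
          exact/measurable_EFinP.
        + move=> y _ /=; rewrite lee_fin (le_trans (bF x y)) //.
          by rewrite !normrM (gtr0_norm a0) normr_nat mulrAC.
      rewrite ge0_integralZl_EFin //.
      + by rewrite -/c -{2}(fineK cfin) -!EFinM mulrAC.
      + apply: measurableT_comp => //; exact/measurable_EFinP.
      + by rewrite mulr_ge0 //; lra.
  rewrite ge0_integralZl_EFin //.
  - apply: lte_mul_pinfty => //; last by case/integrableP: ig.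
    by rewrite lee_fin mulr_ge0 ?fine_ge0 ?integral_ge0 //; lra.
  - by apply: measurableT_comp => //; exact/measurable_EFinP.
  - by rewrite mulr_ge0 ?fine_ge0 ?integral_ge0 //; lra.
have j1 x : x \in D -> mu.-integrable setT (fun y => (Phi2 x y a * fD y)%:E).
  move=> xD; have := integrableZl measurableT (2 * a) if_.
  apply: le_integrable => //.
    apply/measurable_EFinP/measurable_funM => //.
    exact: (measurableT_comp (measurable_Phi2 a) (pair1_measurable x)).
  move=> y _ /=; rewrite lee_fin /fD !patchE.
  case: ifPn => [|_]; last by rewrite !mulr0.
  rewrite !inE in xD * => yD; rewrite !normrM ler_wpM2r // -normrM.
  by apply: le_trans (ler_norm _); exact: Phi2_bound.
have j2 y : y \in D -> mu.-integrable setT (fun x => (Phi2 x y a * gD x)%:E).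
  move=> yD; have := integrableZl measurableT (2 * a) ig.
  apply: le_integrable => //.
    apply/measurable_EFinP/measurable_funM => //.
    exact: (measurableT_comp (measurable_Phi2 a) (pair2_measurable y)).
  move=> x _ /=; rewrite lee_fin /gD !patchE.
  case: ifPn => [|_]; last by rewrite !mulr0.
  rewrite !inE in yD * => xD; rewrite !normrM ler_wpM2r // -normrM.
  by apply: le_trans (ler_norm _); exact: Phi2_bound.
have E0 : \int[mu]_x (0 : R) = 0 by rewrite /Rintegral integral0.
rewrite /inner Rintegral_mkcond [RHS]Rintegral_mkcond -/D.
transitivity (\int[mu]_x (\int[mu]_y F (x, y))).
  apply: eq_Rintegral => x _; rewrite /F /gD /= !patchE; case: ifPn => xD.
    rewrite /B2 Rintegral_mkcond -/D mulrC.
    rewrite (_ : _ \_ D = fun y => Phi2 x y a * fD y); last first.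
      by apply/funext => y; rewrite /fD !patchE; case: ifP => _; rewrite ?mulr0.
    rewrite -RintegralZl //; last exact: j1.
    by apply: eq_Rintegral => y _; rewrite mulrC.
  by under [RHS]eq_Rintegral do rewrite mulr0; rewrite E0.
rewrite Rintegral_Fubini //.
apply: eq_Rintegral => y _; rewrite /F /fD /= !patchE; case: ifPn => yD.
  rewrite /B2adj [in RHS]Rintegral_mkcond -/D.
  rewrite (_ : _ \_ D = fun x => Phi2 x y a * gD x); last first.
    by apply/funext => x; rewrite /gD !patchE; case: ifP => _; rewrite ?mulr0.
  rewrite -RintegralZl //; last exact: j2.
  by apply: eq_Rintegral => x _; rewrite mulrCA mulrA.
by under eq_Rintegral do rewrite mulr0 mul0r; rewrite E0.
Qed.

Definition L2_eigenvalue a A l : Prop :=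
  exists f, [/\ L2 a f, ~ ae_eq mu (`]- a, a[%classic : set R) f (cst 0) &
    ae_eq mu (`]- a, a[%classic : set R) (A f) (fun x => l * f x)].

Definition largest_eigenvalue a A l : Prop :=
  L2_eigenvalue a A l /\ forall m, L2_eigenvalue a A m -> m <= l.

(* A f is an honest function on `]-a, a[ for the integral operators above, and
   the equation is required at every point.  This selects the continuous
   representative of the eigenvector, so that its point values make sense.
   That f is not zero is enforced by the normalization of the eigenfunctions. *)
Definition nonneg_eigenfunction a A l f : Prop :=
  [/\ L2 a f, (forall x, x \in `]- a, a[ -> 0 <= f x) &
    (forall x, x \in `]- a, a[ -> A f x = l * f x)].

(* u = (I + s A)^-1 f on `]-a, a[, again with the pointwise representative. *)
Definition is_resolvent a s A f u : Prop :=
  L2 a u /\ forall x, x \in `]- a, a[ -> u x + s * A u x = f x.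

End GreenOperator.

(* Main.v *)
(** If [cos (omega a) = 0], then [exp (omega^2 t) cos (omega X t)] is a martingale
    that vanishes when [X] exits [(-a, a)], so that optional stopping, carried
    out along dyadic times, gives
    [E [cos (omega X t); no exit before t] = exp (- omega^2 t)].
    Expanding the indicator of [(-a, a)] in the cosines of frequencies
    [(2k+1) pi / (2a)], with Abel summation through the arctangent, yields
    [p2 t a = 4 / pi * sum_k (-1)^k / (2k+1) * exp (- (2k+1)^2 (pi / 2)^2 t / a^2)],
    from which the scaling of [p2] and all the limits in [t] are read off, except
    for small [t / a^2], where continuity of the paths at 0 suffices.  On the
    analytic side, [B2 a f] is the potential [W] with [W'' = - f] that vanishes at
    [-a] and [a]: a positive eigenfunction is therefore a multiple of
    [cos (pi x / (2a))] with eigenvalue [4 a^2 / pi^2], and [I + s B2] is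
    injective, which gives the scaling of [psi2]. *)

Require Import Defs.
From HB Require Import structures.
From mathcomp Require Import all_boot all_order all_algebra.
From mathcomp Require Import all_classical all_reals all_analysis.
From mathcomp Require Import measurable_realfun ring lra zify.

Import Order.TTheory GRing.Theory Num.Theory.
Import numFieldNormedType.Exports.

Local Open Scope classical_set_scope.
Local Open Scope ring_scope.

Set Implicit Arguments.
Unset Strict Implicit.
Unset Printing Implicit Defensive.

(** * Stopping the cosine martingale at the exit time *)

Section BoundedExpectation.
Context (d : measure_display) (T : measurableType d) (R : realType)
        (P : probability T R).
Implicit Types (f g U V : T -> R).

(** Independence is given for finitely many increments only, so the stopping is done for walks on
    dyadic grids. Such a walk jumps over the level [a]; because the cosine vanishes at [a], its
    value just after the exit is at most [omega] times the step, and path continuity sends this to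
    0. Two mismatches remain: [X 0 = 0] holds only almost surely, and a path below [a] at all dyadic
    times may touch [a] between them. They are repaired by working with [X - X 0] and by approaching
    [a] from below.

    The cosine series of the indicator converges only conditionally, so it is first damped by powers
    of [r < 1]. After expectations are taken the terms decay like [exp (- (2k+1)^2 v)] with
    [v = (pi / 2)^2 t / a^2], and the tail bound is free of [r]; hence [r] may tend to 1. The
    constant [4 / pi] is the leading coefficient of a square wave. On the operator side it is [g 0]
    times the integral of [h]: both functions are multiples of one cosine, and the normalization
    fixes exactly the product of the two factors. *)

Lemma bounded_integrable f (M : R) : measurable_fun setT f ->
  (forall w, `|f w| <= M) -> P.-integrable setT (EFin \o f).
Proof.
move=> mf fM; have iM := finite_measure_integrable_cst P M measurableT.
apply: (le_integrable measurableT _ _ iM); first exact/measurable_EFinP.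
by move=> w _ /=; rewrite lee_fin (le_trans (fM w)) // ler_norm.
Qed.

Lemma bounded_cvg_Rintegral (f_ : nat -> T -> R) f (M : R) :
  (forall n, measurable_fun setT (f_ n)) -> measurable_fun setT f ->
  (forall n w, `|f_ n w| <= M) -> (forall w, f_ n w @[n --> \oo] --> f w) ->
  \int[P]_w f_ n w @[n --> \oo] --> \int[P]_w f w.
Proof.
move=> mf_ mf fM cf.
have [//||||if_ _ cI] := @dominated_convergence _ _ _ P setT measurableT
  (fun n => EFin \o f_ n) (EFin \o f) (cst M%:E) _ _ _
  (finite_measure_integrable_cst P M measurableT).
- by move=> n; exact/measurable_EFinP.
- exact/measurable_EFinP.
- by apply: aeW => w _; apply: cvg_EFin => //; [exact: nearW|exact: cf].
- by apply: aeW => w n _ /=; rewrite lee_fin.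
- apply: fine_cvg; rewrite fineK; first exact: cI.
  exact: integrable_fin_num.
Qed.

(** Factorization on rectangles identifies the joint law of [(U, V)] with the product of the two
    laws, by uniqueness of the product measure; Fubini then separates the integrals. *)
Lemma Rintegral_indep U V (M : R) :
  measurable_fun setT U -> measurable_fun setT V ->
  (forall w, `|U w| <= M) -> (forall w, `|V w| <= M) ->
  (forall A B, measurable A -> measurable B ->
     P (U @^-1` A `&` V @^-1` B) = (P (U @^-1` A) * P (V @^-1` B))%E) ->
  \int[P]_w (U w * V w) = (\int[P]_w U w) * (\int[P]_w V w).
Proof.
move=> mU mV bU bV UV.
pose U' : {RV P >-> R} := mfun_Sub (mem_set mU).
pose V' : {RV P >-> R} := mfun_Sub (mem_set mV).
have mW : measurable_fun setT (fun w => (U w, V w)).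
  exact: measurable_fun_pair.
pose W : {mfun T >-> (R * R)%type} := mfun_Sub (mem_set mW).
have dW X : measurable X -> X `<=` setT ->
    (distribution P U' \x distribution P V')%E X = distribution P W X.
  move=> mX _; apply: product_measure_unique mX => A B mA mB.
  exact: UV.
pose F (z : R * R) := (z.1 * z.2)%:E.
have mF : measurable_fun setT F by exact/measurable_EFinP/measurable_funM.
have iUV : P.-integrable setT (fun w => (U w * V w)%:E).
  apply: (@bounded_integrable _ (M * M)); first exact: measurable_funM.
  by move=> w; rewrite normrM ler_pM.
have iF : (distribution P U' \x distribution P V')%E.-integrable setT F.
  apply/integrableP; split => //; rewrite (eq_measure_integral _ dW).
  rewrite ge0_integral_distribution //; last exact: measurableT_comp.
  by case/integrableP : iUV.
have iU := bounded_integrable mU bU; have iV := bounded_integrable mV bV.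
rewrite /Rintegral -fineM ?integrable_fin_num //; congr fine.
transitivity (\int[distribution P W]_z F z)%E.
  by rewrite integral_distribution.
rewrite -(eq_measure_integral _ dW) -(integral12_prod_meas1 iF) /fubini_F /=.
under eq_integral => x _.
  rewrite (_ : \int[_]_y _ = x%:E * \int[P]_w (V w)%:E)%E; last first.
    rewrite integral_distribution /F.
    - by rewrite -integralZl.
    - by apply/measurable_EFinP => /=; apply: measurable_funM.
    - by have := integrableZl measurableT x iV.
  over.
rewrite integral_distribution.
- transitivity (\int[P]_w ((\int[P]_w (V w)%:E) * (U w)%:E))%E.
    by apply: eq_integral => w _; rewrite muleC.
  by rewrite -(fineK (integrable_fin_num measurableT iV)) integralZl // muleC.
- rewrite -(fineK (integrable_fin_num measurableT iV)).
  by apply/measurable_EFinP; exact: measurable_funM.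
- rewrite -(fineK (integrable_fin_num measurableT iV)).
  have := integrableZr measurableT (fine (\int[P]_x (EFin \o V) x)) iU.
  by [].
Qed.

Lemma Rintegral_norm_le f (M : R) : measurable_fun setT f ->
  (forall w, `|f w| <= M) -> `|\int[P]_w f w| <= M.
Proof.
move=> mf fM; have if_ := bounded_integrable mf fM.
apply: le_trans (le_normr_Rintegral measurableT if_) _.
have -> : M = \int[P]_w (cst M w).
  rewrite Rintegral_cst // [X in fine X](_ : _ = 1%:E) ?mulr1 //.
  exact: probability_setT.
apply: le_Rintegral => //; first exact: integrable_norm.
exact: finite_measure_integrable_cst.
Qed.

End BoundedExpectation.

(** * Independence of the next step from the sigma-algebra of the past *)

Section IndependentPast.
Context (d : measure_display) (T : measurableType d) (R : realType)
        (P : probability T R).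
Implicit Types (Y : nat -> T -> R) (U : T -> R).

Lemma fineK_probability (A : set T) : measurable A -> (fine (P A))%:E = P A.
Proof. by move=> mA; rewrite fineK // fin_num_measure. Qed.

(** Cylinders over the first [n] variables: a pi-system, so that independence of the sigma-algebra
    it generates has to be checked on cylinders only. *)
Definition past_events Y (n : nat) : set (set T) :=
  [set E | exists2 B : nat -> set R, (forall i, measurable (B i)) &
     E = [set w | forall i, (i < n)%N -> B i (Y i w)]].

Lemma past_events_setI_closed Y n : setI_closed (past_events Y n).
Proof.
move=> _ _ [B mB ->] [C mC ->]; exists (fun i => B i `&` C i).
  by move=> i; exact: measurableI.
apply/seteqP; split=> w /=.
  by move=> [hB hC] i ilt; split; [exact: hB|exact: hC].
by move=> h; split=> i ilt; case: (h i ilt).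
Qed.

Lemma past_events_measurable Y n E : (forall i, measurable_fun setT (Y i)) ->
  past_events Y n E -> measurable E.
Proof.
move=> mY [B mB ->].
rewrite (_ : [set _ | _] = \bigcap_(i in `I_n) (Y i @^-1` B i)); last first.
  by apply/seteqP; split=> w h i; apply: h.
apply: bigcap_measurableType.
by move=> i _; rewrite -[X in measurable X]setTI; exact: mY.
Qed.

(** Dynkin's argument: the events independent of [C] form a lambda-system, and mutual independence
    puts the cylinders into it. *)
Lemma independent_of_past Y n E (B : set R) :
  (forall i, measurable_fun setT (Y i)) ->
  mutually_independent P (fun i : 'I_n.+1 => Y i) ->
  <<s past_events Y n >> E -> measurable B ->
  P (E `&` Y n @^-1` B) = (P E * P (Y n @^-1` B))%E.
Proof.
move=> mY iY sE mB; set C := Y n @^-1` B.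
have mC : measurable C by rewrite -[X in measurable X]setTI; exact: mY.
pose H := [set E | measurable E /\ P (E `&` C) = (P E * P C)%E].
suff sub : <<s past_events Y n >> `<=` H by case: (sub _ sE).
apply: (@lambda_system_subset _ _ (@past_events_setI_closed Y n) setT H) => //.
- split=> //.
  + by split=> //; rewrite setTI probability_setT mul1e.
  + move=> A A' A'A [mA PA] [mA' PA']; split; first exact: measurableD.
    have Pf (D : set T) : measurable D -> (P D < +oo)%E.
      by move=> mD; rewrite ltey_eq fin_num_measure.
    have -> : (A `\` A') `&` C = (A `&` C) `\` (A' `&` C).
      by apply/seteqP; split=> w /=; tauto.
    have PD (D D' : set T) : measurable D -> measurable D' -> D' `<=` D ->
        P (D `\` D') = (P D - P D')%E.
      by move=> mD mD' D'D; rewrite -{2}(setIidr D'D) measureD ?Pf.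
    rewrite !PD //; [|exact: measurableI|exact: measurableI|exact: setSI].
    rewrite PA PA'.
    have h (x y z : R) : (x%:E * z%:E - y%:E * z%:E = (x%:E - y%:E) * z%:E)%E.
      by rewrite -muleBl.
    by rewrite -(fineK_probability mA) -(fineK_probability mA')
      -(fineK_probability mC); exact: h.
  + move=> F ndF HF; have mF i : measurable (F i) by case: (HF i).
    have mUF : measurable (\bigcup_i F i) by exact: bigcup_measurable.
    split=> //; rewrite setI_bigcupl.
    have c1 : P (F i `&` C) @[i --> \oo] --> P (\bigcup_i (F i `&` C)).
      apply: nondecreasing_cvg_mu.
      * by move=> i; exact: measurableI.
      * by apply: bigcup_measurable => i _; exact: measurableI.
      * by move=> i j ij; apply/subsetPset; apply: setSI; exact/subsetPset/ndF.
    have c2 : (P (F i) * P C)%E @[i --> \oo] --> (P (\bigcup_i F i) * P C)%E.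
      apply: cvgeZr; first exact: fin_num_measure.
      exact: nondecreasing_cvg_mu.
    have FC : (fun i => P (F i `&` C)) = (fun i => P (F i) * P C)%E.
      by apply/funext => i; case: (HF i).
    by rewrite FC in c1; exact: (cvg_unique _ c1 c2).
- move=> A pA; split; first exact: past_events_measurable pA.
  case: pA => D mD ->{A}.
  pose D' (i : 'I_n.+1) := if (i < n)%N then D i else B.
  have mD' i : measurable (D' i) by rewrite /D'; case: ifP.
  (* The full index set describes the cylinder intersected with [C], the indices below [n] the
     cylinder alone; the two products differ by the factor at [ord_max], which is [P C]. *)
  have := iY D' mD' (finset xpredT).
  have := iY D' mD' (finset (fun i : 'I_n.+1 => (i < n)%N)).
  rewrite [in X in _ -> X -> _](bigD1 ord_max) ?inE //= {4}/D' ltnn -/C.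
  have -> : [set w | forall i : 'I_n.+1, i \in finset xpredT -> D' i (Y i w)] =
      [set w | forall i, (i < n)%N -> D i (Y i w)] `&` C.
    apply/seteqP; split=> w /=.
      move=> h; split=> [i ilt|].
        have ilt' : (i < n.+1)%N by rewrite ltnS ltnW.
        by have := h (Ordinal ilt'); rewrite inE /D' /= ilt; apply.
      by have := h ord_max; rewrite inE /D' /= ltnn; apply.
    move=> [h c] i _; rewrite /D'; case: ifPn => [|ige]; first exact: h.
    suff -> : i = ord_max by [].
    by apply/val_inj => /=; have := ltn_ord i; lia.
  have -> : [set w | forall i : 'I_n.+1,
        i \in finset (fun i : 'I_n.+1 => (i < n)%N) -> D' i (Y i w)] =
      [set w | forall i, (i < n)%N -> D i (Y i w)].
    apply/seteqP; split=> w /= h.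
      move=> i ilt; have ilt' : (i < n.+1)%N by rewrite ltnS ltnW.
      by have := h (Ordinal ilt'); rewrite inE /D' /= ilt; apply.
    by move=> i; rewrite inE /D' => ilt; rewrite ilt; exact: h.
  have -> : \prod_(i in finset (fun i : 'I_n.+1 => (i < n)%N))
       fine (P (Y i @^-1` D' i)) =
     \prod_(i in finset xpredT | i != ord_max) fine (P (Y i @^-1` D' i)).
    apply: eq_bigl => i; rewrite !inE /= -val_eqE /=.
    by have := ltn_ord i; lia.
  move=> <- e; have mE : measurable [set w | forall i, (i < n)%N -> D i (Y i w)].
    by apply: (@past_events_measurable Y n) => //; exists D.
  rewrite -(fineK_probability (measurableI _ _ mE mC)) e EFinM muleC.
  by rewrite !fineK_probability.
Qed.

End IndependentPast.

(** * Walks observed until they leave an interval *)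

Section StoppedWalk.
Context (d : measure_display) (T : measurableType d) (R : realType)
        (P : probability T R).
Implicit Types (Y : nat -> T -> R) (U : T -> R) (z : nat -> R).

(** The domain is [T] equipped with the generated sigma-algebra, so that the usual closure rules for
    measurable functions apply to it unchanged. *)
Definition past_measurable Y (n : nat) U : Prop :=
  measurable_fun [set: g_sigma_algebraType (past_events Y n)]
    (U : g_sigma_algebraType (past_events Y n) -> R).

Lemma past_measurable_lt Y n i : (i < n)%N -> past_measurable Y n (Y i).
Proof.
move=> ilt _ B mB; rewrite setTI; apply: sub_sigma_algebra.
exists (fun j => if j == i then B else setT); first by move=> j; case: ifP.
apply/seteqP; split=> w /=.
  by move=> h j _; case: ifP => // /eqP ->.
by move=> /(_ i ilt); rewrite eqxx.
Qed.

Lemma past_measurable_measurable Y n U : (forall i, measurable_fun setT (Y i)) ->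
  past_measurable Y n U -> measurable_fun setT U.
Proof.
move=> mY mU _ B mB.
have := mU measurableT B mB.
rewrite -[X in _ -> X]/([set E | measurable E] (setT `&` U @^-1` B)).
apply: smallest_sub => [|E]; first exact: sigma_algebra_measurable.
exact: past_events_measurable.
Qed.

Lemma Rintegral_past_mul Y n U (phi : R -> R) (M : R) :
  (forall i, measurable_fun setT (Y i)) ->
  mutually_independent P (fun i : 'I_n.+1 => Y i) ->
  past_measurable Y n U -> measurable_fun setT phi ->
  (forall w, `|U w| <= M) -> (forall x, `|phi x| <= M) ->
  \int[P]_w (U w * phi (Y n w)) = (\int[P]_w U w) * (\int[P]_w phi (Y n w)).
Proof.
move=> mY iY pU mphi bU bphi.
apply: (@Rintegral_indep _ _ _ _ _ (phi \o Y n) M) => //.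
- exact: past_measurable_measurable pU.
- exact: measurableT_comp.
- by move=> w; exact: bphi.
- move=> A B mA mB; rewrite comp_preimage.
  apply: independent_of_past => //.
    by have := pU measurableT A mA; rewrite setTI.
  by rewrite -[X in measurable X]setTI; exact: mphi.
Qed.

Definition walk Y (n : nat) (w : T) : R := \sum_(j < n) Y j w.

Fixpoint alive (a : R) (z : nat -> R) (n : nat) : bool :=
  (if n is n'.+1 then alive a z n' else true) && (`|z n| < a).

Lemma aliveP (a : R) z n :
  reflect (forall k, (k <= n)%N -> `|z k| < a) (alive a z n).
Proof.
elim: n => [|n ih] /=.
  apply: (iffP idP) => [h k|]; first by rewrite leqn0 => /eqP ->.
  exact.
apply: (iffP andP) => [[/ih h1 h2] k|h].
  by rewrite leq_eqVlt => /predU1P[->//|]; exact: h1.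
by split; [apply/ih => k kn; apply: h; exact: leqW|exact: h].
Qed.

(** Since [alive] never returns to true, at most one difference of indicators is nonzero, at the
    first exit: this is the modulus of the cosine at the exit position, and 0 when no exit occurs
    among the steps [1] to [n]. *)
Definition exit_cost (a omega : R) z (n : nat) : R :=
  \sum_(i < n) `|cos (omega * z i.+1)| * ((alive a z i)%:R - (alive a z i.+1)%:R).

Lemma cos_lipschitz (x y : R) : `|cos x - cos y| <= `|x - y|.
Proof.
wlog xy : x y / x <= y.
  by move=> h; case: (leP x y) => [/h //|/ltW /h]; rewrite distrC [leRHS]distrC.
have [|c _] := @MVT_segment _ (@cos R) (fun x => - sin x) _ _ xy.
  by apply: continuous_subspaceT => u; exact: continuous_cos.
rewrite distrC [leRHS]distrC => ->; rewrite normrM normrN.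
by rewrite -[leRHS]mul1r ler_wpM2r // sin_max.
Qed.

Lemma exit_cost_ge0 (a omega : R) z n : 0 <= exit_cost a omega z n.
Proof.
apply: sumr_ge0 => i _; apply: mulr_ge0 => //=.
by case: (alive a z i) => /=; case: (_ < a) => /=; rewrite ?subrr ?subr0.
Qed.

(** The indicator differences are nonnegative and telescope to at most 1, so a bound on the cosine
    at exits bounds the whole sum. *)
Lemma exit_cost_le (a omega eta : R) z n : 0 <= eta ->
  (forall i, (i < n)%N -> alive a z i -> ~~ alive a z i.+1 ->
     `|cos (omega * z i.+1)| <= eta) ->
  exit_cost a omega z n <= eta.
Proof.
move=> eta0 h.
apply: (@le_trans _ _ (\sum_(i < n) eta * ((alive a z i)%:R - (alive a z i.+1)%:R))).
  apply: ler_sum => i _; have /= := h i (ltn_ord i).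
  case: (alive a z i) => /=; case: (_ < a) => /=; rewrite ?subrr ?mulr0 //.
  by move=> /(_ isT isT); rewrite subr0 !mulr1.
rewrite -mulr_sumr -(big_mkord xpredT (fun i => (alive a z i)%:R - (alive a z i.+1)%:R)).
rewrite -[leRHS]mulr1; apply: ler_wpM2l => //.
rewrite (@telescope_sumr_eq _ _ _ (fun i => - (alive a z i)%:R)) //.
  have h1 : 0 <= (alive a z n)%:R :> R by exact: ler0n.
  have h2 : (alive a z 0)%:R <= 1 :> R by rewrite lern1 leq_b1.
  by rewrite opprK addrC lerBlDr (le_trans h2) // lerDl.
by move=> i _; rewrite opprK addrC.
Qed.

Lemma exit_cost_le1 (a omega : R) z n : exit_cost a omega z n <= 1.
Proof. by apply: exit_cost_le => // i *; exact: cos_max. Qed.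

(* The walk overshoots the level [a], a zero of [cos (omega * _)], by at most
   one step. *)
Lemma exit_cost_step (a omega eta : R) z n : 0 <= omega -> 0 <= eta ->
  cos (omega * a) = 0 ->
  (forall i, (i < n)%N -> `|z i.+1 - z i| <= eta) ->
  exit_cost a omega z n <= omega * eta.
Proof.
move=> om0 eta0 coa h; apply: exit_cost_le; first exact: mulr_ge0.
move=> i ilt li lSi; have zi : `|z i| < a by apply: (aliveP _ _ _ li).
have zSi : a <= `|z i.+1| by move: lSi; rewrite /= li /= -leNgt.
have -> : cos (omega * z i.+1) = cos (omega * `|z i.+1|).
  by rewrite -[LHS]cos_norm normrM (ger0_norm om0).
rewrite -[X in `|X|]subr0 -coa (le_trans (cos_lipschitz _ _)) //.
rewrite -mulrBr normrM (ger0_norm om0) ler_wpM2l // (le_trans _ (h i ilt)) //.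
rewrite ger0_norm ?subr_ge0 //.
have := ler_dist_dist (z i.+1) (z i); apply: le_trans.
by rewrite ler_normr; apply/orP; left; lra.
Qed.

Lemma measurable_alive d' (S : measurableType d') (z : nat -> S -> R) (a : R) n :
  (forall k, (k <= n)%N -> measurable_fun setT (z k)) ->
  measurable_fun setT (fun w => (alive a (z ^~ w) n)%:R : R).
Proof.
elim: n => [|n ih] mz /=.
  rewrite (_ : (fun _ => _) = fun w => if `|z 0%N w| < a then 1 else 0 : R).
    apply: measurable_fun_ifT => //; apply: measurable_fun_ltr => //.
    by apply: measurableT_comp => //; exact: mz.
  by apply/funext => w /=; case: ifP.
rewrite (_ : (fun _ => _) = fun w => (alive a (z ^~ w) n)%:R *
    (if `|z n.+1 w| < a then 1 else 0 : R)).
  apply: measurable_funM; first by apply: ih => k kn; apply: mz; exact: leqW.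
  apply: measurable_fun_ifT => //; apply: measurable_fun_ltr => //.
  by apply: measurableT_comp => //; exact: mz.
by apply/funext => w /=; case: ifP; rewrite (andbT, andbF) ?mulr1 ?mulr0.
Qed.

End StoppedWalk.

Lemma measurable_cos_scale (R : realType) (c : R) : measurable_fun setT (fun x : R => cos (c * x)).
Proof.
apply: (measurableT_comp (f := @cos R)).
  by apply: continuous_measurable_fun; exact: continuous_cos.
exact: measurable_funM.
Qed.

Lemma measurable_sin_scale (R : realType) (c : R) : measurable_fun setT (fun x : R => sin (c * x)).
Proof.
apply: (measurableT_comp (f := @sin R)).
  by apply: continuous_measurable_fun; exact: continuous_sin.
exact: measurable_funM.
Qed.

(** * The cosine martingale of a walk with independent steps *)

Section StoppedCosine.
Context (d : measure_display) (T : measurableType d) (R : realType)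
        (P : probability T R).
Variable Y : nat -> T -> R.
Variables (a omega rho : R).
Hypothesis mY : forall i, measurable_fun setT (Y i).
Hypothesis iY : forall n, mutually_independent P (fun i : 'I_n => Y i).
Hypothesis a0 : 0 < a.
Hypothesis rho01 : 0 <= rho <= 1.
Hypothesis cosY : forall i, \int[P]_w cos (omega * Y i w) = rho.
Hypothesis sinY : forall i, \int[P]_w sin (omega * Y i w) = 0.

Let W := walk Y.
Let A n w : R := (alive a (W ^~ w) n)%:R.

Let pW n k : (k <= n)%N -> past_measurable Y n (W k).
Proof.
move=> kn; rewrite /past_measurable /W /walk.
apply: measurable_sum => i; apply: past_measurable_lt.
exact: leq_trans (ltn_ord i) kn.
Qed.

Let pA n k : (k <= n)%N -> past_measurable Y n (A k).
Proof.
move=> kn; apply: measurable_alive => j jk; apply: pW; exact: leq_trans kn.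
Qed.

Let mW n : measurable_fun setT (W n).
Proof. exact: (past_measurable_measurable mY (pW (leqnn n))). Qed.

Let mA n : measurable_fun setT (A n).
Proof. exact: (past_measurable_measurable mY (pA (leqnn n))). Qed.

Let A_norm n w : `|A n w| <= 1.
Proof. by rewrite /A; case: (alive _ _ _); rewrite ?normr1 ?normr0. Qed.

Let prod_norm (x y : R) : `|x| <= 1 -> `|y| <= 1 -> `|x * y| <= 1.
Proof. by move=> x1 y1; rewrite normrM -[leRHS]mulr1 ler_pM. Qed.

Lemma measurable_exit_cost n :
  measurable_fun setT (fun w => exit_cost a omega (W ^~ w) n).
Proof.
apply: measurable_sum => i; apply: measurable_funM; last first.
  by apply: measurable_funB; exact: mA.
by apply: measurableT_comp => //; exact: (measurableT_comp (measurable_cos_scale omega) (mW _)).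
Qed.

(** Expand [cos (omega * (W n + Y n))] by the addition formula: both coefficients belong to the
    past, the sine of the new step has mean 0 and its cosine has mean [rho]. *)
Lemma stopped_cosine_step n :
  \int[P]_w (cos (omega * W n.+1 w) * A n w) =
  rho * \int[P]_w (cos (omega * W n w) * A n w).
Proof.
have WS w : W n.+1 w = W n w + Y n w by rewrite /W /walk big_ord_recr.
pose U1 w := cos (omega * W n w) * A n w.
pose U2 w := sin (omega * W n w) * A n w.
have pU1 : past_measurable Y n U1.
  apply: measurable_funM; last exact: pA.
  exact: (measurableT_comp (measurable_cos_scale omega) (pW (leqnn n))).
have pU2 : past_measurable Y n U2.
  apply: measurable_funM; last exact: pA.
  exact: (measurableT_comp (measurable_sin_scale omega) (pW (leqnn n))).
have bU1 w : `|U1 w| <= 1 by apply: prod_norm; [exact: cos_max|exact: A_norm].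
have bU2 w : `|U2 w| <= 1 by apply: prod_norm; [exact: sin_max|exact: A_norm].
transitivity (\int[P]_w (U1 w * cos (omega * Y n w) - U2 w * sin (omega * Y n w))).
  by apply: eq_Rintegral => w _; rewrite WS mulrDr cosD /U1 /U2; ring.
have mU1 := past_measurable_measurable mY pU1.
have mU2 := past_measurable_measurable mY pU2.
rewrite RintegralB //; last 2 first.
- apply: (@bounded_integrable _ _ _ _ _ 1).
    by apply: measurable_funM => //; exact: (measurableT_comp (measurable_cos_scale omega) (mY _)).
  by move=> w; apply: prod_norm => //; exact: cos_max.
- apply: (@bounded_integrable _ _ _ _ _ 1).
    by apply: measurable_funM => //; exact: (measurableT_comp (measurable_sin_scale omega) (mY _)).
  by move=> w; apply: prod_norm => //; exact: sin_max.
rewrite (@Rintegral_past_mul _ _ _ _ _ _ _ (fun x => cos (omega * x)) 1) //;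
  [|exact: measurable_cos_scale|by move=> x; exact: cos_max].
rewrite (@Rintegral_past_mul _ _ _ _ _ _ _ (fun x => sin (omega * x)) 1) //;
  [|exact: measurable_sin_scale|by move=> x; exact: sin_max].
by rewrite cosY sinY mulr0 subr0 mulrC.
Qed.

(* Optional stopping for the martingale [cos (omega W n) / rho ^ n]: the error is
   the contribution of its value just after the exit. *)
Lemma stopped_cosine n :
  `|\int[P]_w (cos (omega * W n w) * A n w) - rho ^+ n|
  <= \int[P]_w exit_cost a omega (W ^~ w) n.
Proof.
have ic k l : P.-integrable setT (EFin \o (fun w => cos (omega * W k w) * A l w)).
  apply: (@bounded_integrable _ _ _ _ _ 1).
    by apply: measurable_funM => //; exact: (measurableT_comp (measurable_cos_scale omega) (mW _)).
  by move=> w; apply: prod_norm => //; exact: cos_max.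
have ie k : P.-integrable setT (EFin \o (fun w => exit_cost a omega (W ^~ w) k)).
  apply: (@bounded_integrable _ _ _ _ _ 1); first exact: measurable_exit_cost.
  by move=> w; rewrite ger0_norm ?exit_cost_ge0 // exit_cost_le1.
elim: n => [|n ih].
  rewrite (_ : \int[P]_w (_ * _) = 1); last first.
    rewrite -[RHS](_ : \int[P]_w 1 = _).
      apply: eq_Rintegral => w _; have W0 : W 0 w = 0 by rewrite /W /walk big_ord0.
      by rewrite /A /= W0 mulr0 cos0 normr0 a0 mulr1.
    rewrite Rintegral_cst // [X in fine X](_ : _ = 1%:E) ?mulr1 //.
    exact: probability_setT.
  by rewrite expr0 subrr normr0; apply: Rintegral_ge0 => w _; exact: exit_cost_ge0.
(* The part of the cosine lost at step [n.+1]: it lives on the paths that exit exactly then. *)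
pose D w := cos (omega * W n.+1 w) * (A n w - A n.+1 w).
have iD : P.-integrable setT (EFin \o D).
  have := integrableB measurableT (ic n.+1 n) (ic n.+1 n.+1).
  by apply: eq_integrable => // w _ /=; rewrite /D mulrBr EFinB.
have VS : \int[P]_w (cos (omega * W n.+1 w) * A n.+1 w) =
    rho * \int[P]_w (cos (omega * W n w) * A n w) - \int[P]_w D w.
  rewrite -stopped_cosine_step -RintegralB //.
  by apply: eq_Rintegral => w _; rewrite /D; ring.
have AS w : 0 <= A n w - A n.+1 w.
  rewrite /A /=; case: (alive a (W ^~ w) n) => /=; rewrite ?subrr //.
  by case: (_ < a); rewrite ?subrr ?subr0.
have iN : P.-integrable setT (EFin \o (fun w => `|D w|)).
  exact: (integrable_norm iD).
have -> : \int[P]_w exit_cost a omega (W ^~ w) n.+1 =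
    \int[P]_w exit_cost a omega (W ^~ w) n + \int[P]_w `|D w|.
  rewrite -RintegralD //; apply: eq_Rintegral => w _.
  by rewrite /exit_cost big_ord_recr /= /D normrM (ger0_norm (AS w)).
rewrite VS exprS.
(* The inherited error is damped by [rho <= 1]; the new one is the summand added to [exit_cost]. *)
rewrite (_ : _ - _ = rho * (\int[P]_w (cos (omega * W n w) * A n w) - rho ^+ n)
   - \int[P]_w D w); last by ring.
rewrite (le_trans (ler_normB _ _)) // lerD //; last exact: le_normr_Rintegral.
case/andP: rho01 => r0 r1.
by rewrite normrM (ger0_norm r0) (le_trans _ ih) // ler_piMl.
Qed.

End StoppedCosine.

(** Heine-Cantor: compactness as a covering property turns local radii into a radius valid on the
    whole segment. *)
Lemma within_segment_unif_continuous (R : realType) (f : R -> R) (a b e : R) :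
  {within `[a, b], continuous f} -> 0 < e ->
  exists2 r : R, 0 < r & forall x y, x \in `[a, b] -> y \in `[a, b] ->
    `|x - y| < r -> `|f x - f y| < e.
Proof.
move=> /subspace_continuousP cf e0.
have := @segment_compact R a b; rewrite compact_near_coveringP.
move=> /(_ R (0^'+) (fun r x => forall y, x \in `[a, b] -> y \in `[a, b] ->
    `|x - y| < r -> `|f x - f y| < e)) cov.
suff loc : forall x, `[a, b]%classic x -> \forall x' \near x & r \near 0^'+,
    forall y, x' \in `[a, b] -> y \in `[a, b] -> `|x' - y| < r -> `|f x' - f y| < e.
  have hf := cov _ loc.
  have /filter_ex : \forall r \near 0^'+, `[a, b]%classic `<=` (fun x => forall y,
      x \in `[a, b] -> y \in `[a, b] -> `|x - y| < r -> `|f x - f y| < e) /\ 0 < r.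
    near=> r; split; first by near: r; exact: hf.
    by near: r; exact: nbhs_right_gt.
  move=> [r [hr r0]]; by exists r => // x y xK yK; exact: hr.
move=> x Kx.
  have /cvgrPdist_lt/(_ (e / 2)) := cf x Kx.
  rewrite divr_gt0 // => /(_ isT); rewrite near_withinE => -[r /= r0 xr].
  (* Half of the radius for the centre and half for the distance keep both points within [r] of
     [x]. *)
  exists (ball x (r / 2), [set s | s < r / 2]).
    split; first by apply: nbhsx_ballx; rewrite divr_gt0.
    by apply: nbhs_right_lt; rewrite divr_gt0.
  move=> [y s] [/= xy sr] z yK zK yz.
  have h1 := xr y; have h2 := xr z.
  have d1 : `|x - y| < r by rewrite (lt_trans xy) // ltr_pdivrMr // ltr_pMr //; lra.
  have d2 : `|x - z| < r.
    have := ler_normD (x - y) (y - z); rewrite addrA subrK => hh.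
    rewrite /ball /= in xy; lra.
  have := h1 d1 yK; have := h2 d2 zK; move=> b1 b2.
  rewrite (le_lt_trans (ler_distD (f x) _ _)) // (splitr e) ltrD //.
  by rewrite distrC.
Unshelve. all: end_near. Qed.

(** * The Wiener process along dyadic times *)

Section WienerCosine.
Context (d : measure_display) (T : measurableType d) (R : realType)
        (P : probability T R) (X : R -> T -> R).
Hypothesis hX : wiener_process P X.

Lemma Rintegral_eq_law (U V : T -> R) (phi : R -> R) (M : R) :
  measurable_fun setT U -> measurable_fun setT V -> measurable_fun setT phi ->
  (forall x, `|phi x| <= M) ->
  (forall B : set R, measurable B -> P (U @^-1` B) = P (V @^-1` B)) ->
  \int[P]_w phi (U w) = \int[P]_w phi (V w).
Proof.
move=> mU mV mphi bphi UV.
pose U' : {RV P >-> R} := mfun_Sub (mem_set mU).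
pose V' : {RV P >-> R} := mfun_Sub (mem_set mV).
have mE : measurable_fun setT (EFin \o phi) by exact/measurable_EFinP.
congr fine.
transitivity (\int[distribution P U']_x (phi x)%:E)%E.
  rewrite integral_distribution //.
  apply: (@bounded_integrable _ _ _ _ (phi \o U) M) => [|w]; last exact: bphi.
  exact: measurableT_comp.
transitivity (\int[distribution P V']_x (phi x)%:E)%E.
  by apply: eq_measure_integral => B mB _; exact: UV.
rewrite integral_distribution //.
apply: (@bounded_integrable _ _ _ _ (phi \o V) M) => [|w]; last exact: bphi.
exact: measurableT_comp.
Qed.

Lemma measurable_increment s t : 0 <= s -> 0 <= t ->
  measurable_fun setT (fun w => X t w - X s w).
Proof. by move=> s0 t0; apply: measurable_funB; exact: (wiener_measurable hX). Qed.

Lemma wiener_cos omega t : 0 <= t ->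
  \int[P]_w cos (omega * X t w) = expR (- (t * omega ^+ 2)) /\
  \int[P]_w sin (omega * X t w) = 0.
Proof.
move=> t0; have := wiener_charfun hX omega t0.
rewrite /characteristic_function /Defs.expi unlock /=.
by case=> h1 h2; split.
Qed.

Lemma increment_cos omega s t : 0 <= s -> s <= t ->
  \int[P]_w cos (omega * (X t w - X s w)) = expR (- ((t - s) * omega ^+ 2)) /\
  \int[P]_w sin (omega * (X t w - X s w)) = 0.
Proof.
move=> s0 st; have t0 := le_trans s0 st.
have ts0 : 0 <= t - s by rewrite subr_ge0.
have [<- <-] := wiener_cos omega ts0; split.
  apply: (@Rintegral_eq_law (fun w => X t w - X s w) (X (t - s))
    (fun x => cos (omega * x)) 1).
  - exact: measurable_increment.
  - exact: (wiener_measurable hX).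
  - exact: measurable_cos_scale.
  - by move=> x; exact: cos_max.
  - by move=> B mB; exact: (wiener_stationary hX).
apply: (@Rintegral_eq_law (fun w => X t w - X s w) (X (t - s))
    (fun x => sin (omega * x)) 1).
- exact: measurable_increment.
- exact: (wiener_measurable hX).
- exact: measurable_sin_scale.
- by move=> x; exact: sin_max.
- by move=> B mB; exact: (wiener_stationary hX).
Qed.

Definition dyadic (t : R) (m k : nat) : R := t * (k%:R / 2 ^+ m).

Lemma dyadic_ge0 t m k : 0 <= t -> 0 <= dyadic t m k.
Proof. by move=> t0; rewrite mulr_ge0 // divr_ge0 // exprn_ge0. Qed.

Lemma dyadic_le t m k : 0 <= t -> (k <= 2 ^ m)%N -> dyadic t m k <= t.
Proof.
move=> t0 km; rewrite ler_piMr // ler_pdivrMr ?exprn_gt0 // mul1r.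
by rewrite -natrX ler_nat.
Qed.

Lemma dyadic_max t m : dyadic t m (2 ^ m) = t.
Proof. by rewrite /dyadic natrX divff ?mulr1 // expf_neq0. Qed.

Lemma dyadic0 t m : dyadic t m 0 = 0.
Proof. by rewrite /dyadic mul0r mulr0. Qed.

Lemma dyadic_refine t m n k : dyadic t (m + n) (k * 2 ^ n) = dyadic t m k.
Proof.
rewrite /dyadic natrM natrX exprD invfM.
congr (_ * _); rewrite mulrACA divff ?mulr1 // expf_neq0 //.
Qed.

Lemma dyadic_step t m k : dyadic t m k.+1 - dyadic t m k = t / 2 ^+ m.
Proof. by rewrite /dyadic -mulrBr -mulrBl -natrB // subSnn mul1r. Qed.

(** Dyadic times make this a countable intersection of events, and subtracting [X 0] makes every
    path start at 0 exactly, as the walk of its increments does. *)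
Definition stays_inside (t a : R) : set T :=
  [set w | forall m k, (k <= 2 ^ m)%N -> `|X (dyadic t m k) w - X 0 w| < a].

Let W t m (k : nat) w := X (dyadic t m k) w - X 0 w.

Lemma measurable_stays_inside t a : 0 <= t -> measurable (stays_inside t a).
Proof.
move=> t0; rewrite (_ : stays_inside t a =
  \bigcap_m \bigcap_(k in [set k | (k <= 2 ^ m)%N])
    (fun w => `|W t m k w|) @^-1` [set x | x < a]); last first.
  apply/seteqP; split=> w h m; first by move=> _ k; exact: h.
  by move=> k km; exact: (h m I k km).
apply: bigcap_measurableType => m _; apply: bigcap_measurableType => k _.
rewrite -[X in measurable X]setTI.
have : measurable_fun setT (fun w => `|W t m k w|).
  apply: measurableT_comp => //; apply: measurable_increment => //.
  exact: dyadic_ge0.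
apply => //; rewrite (_ : [set x | x < a] = `]-oo, a[%classic) //.
Qed.

(** The grids are nested, so a path found outside at one dyadic time is found outside on every finer
    grid. *)
Lemma alive_cvg t a w :
  (alive a (fun k => W t m k w) (2 ^ m))%:R @[m --> \oo] -->
  (\1_(stays_inside t a) w : R).
Proof.
rewrite indicE; have [/set_mem h|/negP h] := boolP (w \in stays_inside t a).
  rewrite (_ : (fun m => _) = fun=> 1); first exact: cvg_cst.
  apply/funext => m; suff -> : alive a (fun k => W t m k w) (2 ^ m) by [].
  by apply/aliveP => k km; exact: h.
have [m0 [k0 [k0m0 ge]]] : exists m k, (k <= 2 ^ m)%N /\ a <= `|W t m k w|.
  apply: contrapT => hn; apply: h; apply/mem_set => m k km.
  by rewrite ltNge; apply/negP => ge; apply: hn; exists m, k.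
apply: cvg_near_cst; exists m0 => // m /= m0m.
suff /negbTE -> : ~~ alive a (fun k => W t m k w) (2 ^ m) by [].
(* The index on the grid of level [m] of the time that has index [k0] on level [m0]. *)
apply/negP => /aliveP /(_ (k0 * 2 ^ (m - m0))%N).
rewrite -[X in (_ <= 2 ^ X)%N](subnKC m0m) expnD leq_mul2r k0m0 orbT => /(_ isT).
by rewrite /W -[X in dyadic t X](subnKC m0m) dyadic_refine ltNge ge.
Qed.

(** Uniform continuity of the path on [[0, t]] makes all steps of the walk small on a fine grid, and
    [exit_cost_step] applies. *)
Lemma exit_cost_cvg t a omega w : 0 <= t -> 0 <= omega -> cos (omega * a) = 0 ->
  exit_cost a omega (fun k => W t m k w) (2 ^ m) @[m --> \oo] --> (0 : R).
Proof.
move=> t0 om0 coa; apply/cvgrPdist_le => e e0.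
have cX : {within `[0, t], continuous (X ^~ w)}.
  apply: continuous_subspaceW (@wiener_continuous _ _ _ _ _ hX w).
  by move=> x /=; rewrite !in_itv /= => /andP[-> _].
(* The added 1 covers [omega = 0]; [omega] times this bound is still at most [e]. *)
have e1 : 0 < e / (omega + 1) by rewrite divr_gt0 // ltr_wpDl.
have [r r0 hr] := within_segment_unif_continuous cX e1.
have : t / 2 ^+ m @[m --> \oo] --> (0 : R).
  rewrite (_ : (fun m => _) = geometric t 2^-1).
    by apply: cvg_geometric; rewrite gtr0_norm ?invf_lt1 ?ltr1n.
  by apply/funext => m; rewrite /= exprVn.
move=> /cvgrPdist_lt /(_ r r0) near_r.
near=> m; rewrite sub0r normrN ger0_norm ?exit_cost_ge0 //.
apply: le_trans (_ : omega * (e / (omega + 1)) <= e); last first.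
  by rewrite mulrCA ler_piMr ?(ltW e0) // ler_pdivrMr ?ltr_wpDl // mul1r lerDl.
apply: exit_cost_step => //; first exact: ltW.
move=> i im; rewrite /W opprB addrA subrK; apply/ltW/hr.
- by rewrite in_itv /= dyadic_ge0 // dyadic_le.
- by rewrite in_itv /= dyadic_ge0 // dyadic_le // ltnW.
- rewrite dyadic_step -[X in `|X|]opprK normrN -sub0r.
  by near: m; exact: near_r.
Unshelve. all: end_near. Qed.

Lemma walk_increments t m k w :
  walk (fun j w => X (dyadic t m j.+1) w - X (dyadic t m j) w) k w = W t m k w.
Proof.
rewrite /walk -(big_mkord xpredT
  (fun j => X (dyadic t m j.+1) w - X (dyadic t m j) w)).
by rewrite (@telescope_sumr_eq _ _ _ (fun j => X (dyadic t m j) w)) // dyadic0.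
Qed.

(** Refine the grid in [stopped_cosine]. With [2 ^ m] steps of length [t / 2 ^ m], the power of
    [rho] is the right-hand side at every level, so only the exit cost depends on the grid, and it
    tends to 0 by bounded convergence. *)
Lemma stays_inside_cosine t a omega : 0 <= t -> 0 < a -> 0 <= omega ->
  cos (omega * a) = 0 ->
  \int[P]_w (cos (omega * (X t w - X 0 w)) * \1_(stays_inside t a) w) =
  expR (- (t * omega ^+ 2)).
Proof.
move=> t0 a0 om0 coa.
pose Y m j w := X (dyadic t m j.+1) w - X (dyadic t m j) w.
have dS m j : dyadic t m j <= dyadic t m j.+1.
  by rewrite -subr_ge0 dyadic_step divr_ge0 // exprn_ge0.
have mY m j : measurable_fun setT (Y m j).
  by apply: measurable_increment; exact: dyadic_ge0.
have WE m w : walk (Y m) ^~ w = W t m ^~ w.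
  by apply/funext => k; exact: walk_increments.
pose A m w : R := (alive a (W t m ^~ w) (2 ^ m))%:R.
have mA m : measurable_fun setT (A m).
  by apply: measurable_alive => k _; apply: measurable_increment => //; exact: dyadic_ge0.
have mc : measurable_fun setT (fun w => cos (omega * (X t w - X 0 w))).
  exact: (measurableT_comp (measurable_cos_scale omega) (measurable_increment _ _)).
have c1 : \int[P]_w (cos (omega * (X t w - X 0 w)) * A m w) @[m --> \oo] -->
    \int[P]_w (cos (omega * (X t w - X 0 w)) * \1_(stays_inside t a) w).
  apply: (@bounded_cvg_Rintegral _ _ _ _ _ _ 1).
  - by move=> m; exact: measurable_funM.
  - by apply: measurable_funM => //; exact/measurable_indic/measurable_stays_inside.
  - move=> m w; rewrite normrM -[leRHS]mulr1 ler_pM ?cos_max // /A.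
    by case: (alive _ _ _); rewrite ?normr1 ?normr0.
  - by move=> w; apply: cvgMl_tmp; exact: alive_cvg.
have c2 : \int[P]_w exit_cost a omega (W t m ^~ w) (2 ^ m) @[m --> \oo] --> (0 : R).
  rewrite (_ : 0 = \int[P]_w (cst 0 w)); last by rewrite /Rintegral integral0.
  apply: (@bounded_cvg_Rintegral _ _ _ _ _ _ 1) => //.
  - move=> m; rewrite (_ : (fun w => _) = (fun w =>
      exit_cost a omega (walk (Y m) ^~ w) (2 ^ m))); last first.
      by apply/funext => w; rewrite WE.
    exact: measurable_exit_cost.
  - by move=> m w; rewrite ger0_norm ?exit_cost_ge0 // exit_cost_le1.
  - by move=> w; exact: exit_cost_cvg.
have le12 m : `|\int[P]_w (cos (omega * (X t w - X 0 w)) * A m w) -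
    expR (- (t * omega ^+ 2))| <= \int[P]_w exit_cost a omega (W t m ^~ w) (2 ^ m).
  have := @stopped_cosine _ _ _ P (Y m) a omega (expR (- (t / 2 ^+ m * omega ^+ 2)))
    (mY m) _ a0 _ _ _ (2 ^ m).
  rewrite -expRM_natl natrX.
  rewrite (_ : 2 ^+ m * - _ = - (t * omega ^+ 2)); last first.
    by field; rewrite expf_neq0.
  have -> : \int[P]_w (cos (omega * walk (Y m) (2 ^ m) w) *
      (alive a (walk (Y m) ^~ w) (2 ^ m))%:R) =
      \int[P]_w (cos (omega * (X t w - X 0 w)) * A m w).
    by apply: eq_Rintegral => w _; rewrite WE walk_increments /W dyadic_max.
  have -> : \int[P]_w exit_cost a omega (walk (Y m) ^~ w) (2 ^ m) =
      \int[P]_w exit_cost a omega (W t m ^~ w) (2 ^ m).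
    by apply: eq_Rintegral => w _; rewrite WE.
  apply.
  - move=> n; apply: (wiener_independent hX); first by rewrite dyadic0.
    by move=> i _; exact: dS.
  - by rewrite expR_ge0 /= expR_le1 oppr_le0 !mulr_ge0 ?invr_ge0 ?exprn_ge0.
  - move=> i; have [e _] := @increment_cos omega _ _ (dyadic_ge0 m i t0) (dS m i).
    by rewrite /Y e dyadic_step.
  - by move=> i; have [_] := @increment_cos omega _ _ (dyadic_ge0 m i t0) (dS m i).
have c3 : `|\int[P]_w (cos (omega * (X t w - X 0 w)) * A m w) -
    expR (- (t * omega ^+ 2))| @[m --> \oo] --> (0 : R).
  apply: (squeeze_cvgr _ (cvg_cst 0) c2).
  by apply: nearW => m; rewrite normr_ge0 le12.
apply: (cvg_unique _ c1) => //.
exact/subr_cvg0/norm_cvg0P.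
Qed.

End WienerCosine.

(** * From cosines to the indicator of the interval *)

Section AbelSum.
Variable R : realType.
Implicit Types (theta r q : R) (N k : nat).

Let x theta k : R := (-1) ^+ k * cos ((k.*2.+1)%:R * theta).

Let sign_cos_norm k (y : R) : `|(-1) ^+ k * cos y| <= 1.
Proof. by rewrite normrM normrX normrN1 expr1n mul1r cos_max. Qed.

(** Partial sum, damped by [r], of the Fourier series of the square wave [pi / 4] times the sign of
    [cos theta]. *)
Definition abel_sum theta r N : R :=
  \sum_(k < N) r ^+ k.*2.+1 / (k.*2.+1)%:R *
    ((-1) ^+ k * cos ((k.*2.+1)%:R * theta)).

(** Real part of a geometric sum of ratio [- q exp (2 i theta)], with the denominator
    [|1 + q exp (2 i theta)|^2] cleared. The induction uses the three-term recurrence of the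
    cosines; the angle [2 N theta - theta] gives the preceding term a meaning at [N = 0]. *)
Lemma alternating_cos_geometric theta q N :
  (1 + 2 * q * cos (2 * theta) + q ^+ 2) * (\sum_(k < N) q ^+ k * x theta k) =
  (1 + q) * cos theta -
  q ^+ N * (x theta N + q * ((-1) ^+ N * cos ((N.*2)%:R * theta - theta))).
Proof.
elim: N => [|N ih].
  by rewrite big_ord0 /x !expr0 !mul1r mul0r sub0r cosN mulr0; ring.
rewrite big_ord_recr /= mulrDr ih.
have -> : (N.+1.*2)%:R * theta - theta = (N.*2.+1)%:R * theta.
  by rewrite doubleS -!natr1; ring.
have xS : x theta N.+1 = - (2 * cos (2 * theta)) * x theta N +
    (-1) ^+ N * cos ((N.*2)%:R * theta - theta).
  rewrite /x doubleS exprS.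
  have -> : (N.*2.+3)%:R * theta = (N.*2.+1)%:R * theta + 2 * theta.
    by rewrite -!natr1; ring.
  have -> : (N.*2)%:R * theta - theta = (N.*2.+1)%:R * theta - 2 * theta.
    by rewrite -!natr1; ring.
  by rewrite cosD cosB; ring.
by rewrite xS !exprS /x; ring.
Qed.

Lemma is_derive_pow n r : is_derive r 1 (fun y : R => y ^+ n) (n%:R * r ^+ n.-1).
Proof.
rewrite (_ : (fun y : R => y ^+ n) = (id : R -> R) ^+ n); last first.
  by apply/funext => y; rewrite exprfctE.
by apply: is_derive_eq; rewrite /GRing.scale /= mulr1.
Qed.

Lemma is_derive_abel_sum theta r N :
  is_derive r 1 (abel_sum theta ^~ N) (\sum_(k < N) (r ^+ 2) ^+ k * x theta k).
Proof.
elim: N => [|N ih].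
  rewrite /abel_sum (_ : (fun _ => _) = cst 0) ?big_ord0; first exact: is_derive_cst.
  by apply/funext => y; rewrite big_ord0.
rewrite (_ : abel_sum theta ^~ N.+1 = (abel_sum theta ^~ N) +
    (x theta N / (N.*2.+1)%:R) *: (fun y : R => y ^+ N.*2.+1)); last first.
  apply/funext => y; rewrite addrfctE scalrfctE /abel_sum big_ord_recr /= /x.
  by congr (_ + _); rewrite /GRing.scale /=; ring.
rewrite big_ord_recr /=.
have dp := is_derive_pow N.*2.+1 r.
apply: (is_derive_eq (is_deriveD ih (is_deriveZ _ dp))).
rewrite /GRing.scale /= -exprM mul2n mulrA divfK ?pnatr_eq0 //.
by rewrite mulrC.
Qed.

(** The differentiated function is the real part of the complex arctangent of [r exp (i theta)],
    whose power series is the limit of [abel_sum]. *)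
Lemma is_derive_abel_limit theta r : r ^+ 2 < 1 ->
  is_derive r 1 (fun y => 2^-1 * atan (2 * y * cos theta / (1 - y ^+ 2)))
   ((1 + r ^+ 2) * cos theta / (1 + 2 * r ^+ 2 * cos (2 * theta) + (r ^+ 2) ^+ 2)).
Proof.
move=> r1; set c := cos theta.
have q0 : 1 - r ^+ 2 != 0 by rewrite subr_eq0 eq_sym lt_eqF.
(* By the double angle formula this is the denominator in the statement, now visibly positive. *)
have D0 : 0 < (1 - r ^+ 2) ^+ 2 + 4 * r ^+ 2 * c ^+ 2.
  apply: ltr_pwDl; first by rewrite exprn_even_gt0.
  by have := mulr_ge0 (sqr_ge0 r) (sqr_ge0 c); lra.
have dh : is_derive r 1 (fun y => 2 * y * c / (1 - y ^+ 2))
    (2 * c * (1 + r ^+ 2) / (1 - r ^+ 2) ^+ 2).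
  have dp := is_derive_pow 2 r.
  have dq : is_derive r 1 (fun y : R => 1 - y ^+ 2) (- (2 * r)).
    rewrite (_ : (fun y : R => _) = cst 1 - (fun y : R => y ^+ 2)) //.
    by apply: is_derive_eq; rewrite sub0r expr1.
  have dV := @is_deriveV _ (fun y : R => 1 - y ^+ 2) r _ 1 q0 dq.
  have dn : is_derive r 1 (fun y : R => 2 * y * c) (2 * c).
    rewrite (_ : (fun y : R => _) = (2 * c) *: id); last first.
      by apply/funext => y; rewrite fctE; rewrite /GRing.scale /=; ring.
    by apply: is_derive_eq; rewrite /GRing.scale /= mulr1.
  rewrite (_ : (fun y : R => _) = (fun y : R => 2 * y * c) *
    (fun y => (1 - y ^+ 2)^-1)) //.
  by apply: is_derive_eq; rewrite /GRing.scale /=; field.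
rewrite (_ : (fun y : R => _) = 2^-1 *: (atan \o (fun y => 2 * y * c / (1 - y ^+ 2)))) //.
have c2 : cos (2 * theta) = 2 * c ^+ 2 - 1 by rewrite mulr_natl cos_mulr2n -mulr_natl.
apply: is_derive_eq; rewrite /GRing.scale /= c2.
field; rewrite q0 andbT gt_eqF //.
by move: D0; congr (_ < _); ring.
Qed.

(* The partial sum and the arctangent agree at [r = 0], and their derivatives
   in [r] differ by the geometric remainder. *)
Lemma abel_sum_atan theta r N : 0 <= r < 1 ->
  `|abel_sum theta r N - 2^-1 * atan (2 * r * cos theta / (1 - r ^+ 2))| <=
  2 * (r ^+ 2) ^+ N / (1 - r ^+ 2) ^+ 2.
Proof.
move=> /andP[r0 r1].
have bq y : 0 <= y <= r -> 0 <= y ^+ 2 <= r ^+ 2.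
  by move=> /andP[y0 yr]; rewrite sqr_ge0 /= ler_sqr ?nnegrE.
have r21 : r ^+ 2 < 1 by rewrite expr_lt1.
pose G y := abel_sum theta y N - 2^-1 * atan (2 * y * cos theta / (1 - y ^+ 2)).
pose D y := 1 + 2 * y ^+ 2 * cos (2 * theta) + (y ^+ 2) ^+ 2.
pose dG y := - ((y ^+ 2) ^+ N * (x theta N + y ^+ 2 *
   ((-1) ^+ N * cos ((N.*2)%:R * theta - theta)))) / D y.
(* As the cosine is at least -1, [D y] is at least [(1 - y ^+ 2) ^+ 2], which decreases on
   [[0, r]]. *)
have Dge y : 0 <= y <= r -> (1 - r ^+ 2) ^+ 2 <= D y.
  move=> /bq /andP[h1 h2]; have := cos_geN1 (2 * theta).
  rewrite /D; move: (y ^+ 2) (r ^+ 2) r21 h1 h2 (cos _) => q p p1 q0 qp k k1.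
  have : 0 <= q * (k + 1) by rewrite mulr_ge0 //; lra.
  have : 0 <= (p - q) * (2 - p - q) by rewrite mulr_ge0 //; lra.
  by rewrite !expr2; lra.
have D0 : 0 < (1 - r ^+ 2) ^+ 2 by rewrite exprn_gt0 // subr_gt0.
have isG y : 0 <= y <= r -> is_derive y 1 G (dG y).
  move=> yr; have y21 : y ^+ 2 < 1.
    by case/bq/andP : yr => _ h; exact: le_lt_trans r21.
  have d1 := is_derive_abel_sum theta y N; have d2 := is_derive_abel_limit theta y21.
  have Dy : D y != 0 by rewrite gt_eqF // (lt_le_trans D0) // Dge.
  rewrite /G (_ : (fun y => _) = (abel_sum theta ^~ N) -
    (fun y => 2^-1 * atan (2 * y * cos theta / (1 - y ^+ 2)))) //.
  apply: is_derive_eq.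
  (* In closed form the main part of the sum cancels the derivative of the arctangent and leaves
     [dG y]. *)
  have -> : \sum_(k < N) (y ^+ 2) ^+ k * x theta k = ((1 + y ^+ 2) * cos theta -
      (y ^+ 2) ^+ N * (x theta N + y ^+ 2 *
        ((-1) ^+ N * cos ((N.*2)%:R * theta - theta)))) / D y.
    by rewrite -alternating_cos_geometric -/(D y) [RHS]mulrC mulKf.
  by rewrite -/(D y) /dG -mulrBl; congr (_ / _); ring.
have [||c] := @MVT_segment _ G dG 0 r r0.
  by move=> y; rewrite in_itv /= => /andP[/ltW y0 /ltW yr]; apply: isG; rewrite y0.
  apply: derivable_within_continuous => y; rewrite in_itv /= => /isG.
  by move=> [].
rewrite in_itv /= => cr; rewrite subr0.
have -> : G 0 = 0.
  rewrite /G /abel_sum big1 ?mulr0 ?mul0r ?atan0 ?mulr0 ?subr0 // => i _.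
  by rewrite expr0n /= !mul0r.
rewrite subr0 -/(G r) => ->.
rewrite normrM (ger0_norm r0) -[leRHS]mulr1 ler_pM // ?(ltW r1) //.
have /andP[q0 qr] := bq c cr.
rewrite /dG normrM normfV (gtr0_norm (lt_le_trans D0 (Dge c cr))).
have Dc := Dge c cr; have Dc0 := lt_le_trans D0 Dc.
apply: ler_pM => //; [by rewrite invr_ge0 ltW| |by rewrite lef_pV2 ?posrE].
rewrite normrN normrM [leRHS]mulrC; apply: ler_pM => //.
  by rewrite normrX ger0_norm // lerXn2r ?nnegrE // sqr_ge0.
rewrite (le_trans (ler_normD _ _)) // -[2]/(1 + 1) lerD //.
  exact: sign_cos_norm.
have ql1 : `|c ^+ 2| <= 1 by rewrite ger0_norm // (le_trans qr) // ltW.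
have := ler_pM (normr_ge0 _) (normr_ge0 _) ql1
  (sign_cos_norm N ((N.*2)%:R * theta - theta)).
by rewrite mulr1 -normrM.
Qed.
End AbelSum.

(** * The exponential series and its tail *)

Section ExitSeries.
Variable R : realType.
Implicit Types (r v : R) (N M k : nat).

Lemma cos_odd_pihalf k : cos ((k.*2.+1)%:R * (pi / 2)) = 0 :> R.
Proof.
elim: k => [|k ih]; first by rewrite mul1r cos_pihalf.
have -> : (k.+1.*2.+1)%:R * (pi / 2) = (k.*2.+1)%:R * (pi / 2) + pi :> R.
  by rewrite doubleS -!natr1; field.
by rewrite cosD ih cospi sinpi; ring.
Qed.

(** The term of [abel_sum] with its cosine replaced by the expectation of that cosine over the paths
    that stay inside. *)
Definition exit_term r k v : R :=
  r ^+ k.*2.+1 / (k.*2.+1)%:R * ((-1) ^+ k * expR (- ((k.*2.+1)%:R ^+ 2 * v))).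

Definition exit_sum r N v : R := \sum_(k < N) exit_term r k v.

(* Geometric majorant of the terms of index at least [N], from
   [(2 k + 1) ^ 2 >= 1 + 8 k]. *)
Definition exit_tail N v : R :=
  expR (- v) * expR (- (8 * v)) ^+ N / (1 - expR (- (8 * v))).

Lemma exit_term_le r k v : 0 <= r <= 1 -> 0 <= v ->
  `|exit_term r k v| <= expR (- v) * expR (- (8 * v)) ^+ k.
Proof.
move=> /andP[r0 r1] v0; rewrite /exit_term !normrM [`|(-1) ^+ k|]normrX normrN1 expr1n mul1r.
rewrite (ger0_norm (expR_ge0 _)) -[leRHS]mul1r ler_pM ?expR_ge0 ?mulr_ge0 //.
  rewrite normfV normr_nat ler_pdivrMr ?ltr0n // mul1r normrX ger0_norm //.
  by rewrite (le_trans (exprn_ile1 _ r0 r1)) // ler1n.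
have h : 1 + 8 * k%:R <= (k.*2.+1)%:R ^+ 2 :> R.
  rewrite -natrX -natrM -[1]/(1%:R) -natrD ler_nat -muln2.
  by case: k => [|k] //; nia.
rewrite -expRM_natl -expRD ler_expR.
have := ler_wpM2r v0 h; lra.
Qed.

Lemma exit_sum_cauchy r N M v : 0 <= r <= 1 -> 0 < v -> (N <= M)%N ->
  `|exit_sum r M v - exit_sum r N v| <= exit_tail N v.
Proof.
move=> r01 v0 NM; pose p := expR (- (8 * v)) : R.
have p1 : p < 1 by rewrite expR_lt1 oppr_lt0 mulr_gt0.
have p0 : 0 < p := expR_gt0 _.
have p1' : 0 < 1 - p by rewrite subr_gt0.
(* The induction needs the exact finite geometric sum; dropping [p ^+ M] afterwards gives the
   tail. *)
suff : `|exit_sum r M v - exit_sum r N v| <=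
    expR (- v) * (p ^+ N - p ^+ M) / (1 - p).
  move/le_trans; apply; rewrite /exit_tail -/p.
  apply: ler_wpM2r; first by rewrite invr_ge0 ltW.
  by apply: ler_wpM2l; rewrite ?expR_ge0 // gerBl exprn_ge0 // ltW.
rewrite -(subnKC NM); elim: (M - N)%N => [|n ih].
  by rewrite addn0 !subrr normr0 mulr0 mul0r.
rewrite addnS /exit_sum big_ord_recr /= -/(exit_sum _ _ _) addrAC.
rewrite (le_trans (ler_normD _ _)) //.
apply: le_trans (lerD ih (exit_term_le (N + n) r01 (ltW v0))) _.
rewrite -/p le_eqVlt; apply/orP; left; apply/eqP.
rewrite exprS; field; by rewrite gt_eqF.
Qed.
End ExitSeries.

(** * From cosine expectations to the probability of staying inside *)

Section ExitProbability.
Context (d : measure_display) (T : measurableType d) (R : realType)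
        (P : probability T R) (X : R -> T -> R).
Hypothesis hX : wiener_process P X.
Variables t a : R.
Hypotheses (t0 : 0 < t) (a0 : 0 < a).

Let v := t / a ^+ 2 * (pi / 2) ^+ 2.
Let S := stays_inside X t a.
Let th w := pi / (2 * a) * (X t w - X 0 w).

Let mS : measurable S.
Proof. exact: (measurable_stays_inside hX _ (ltW t0)). Qed.

Let mth : measurable_fun setT th.
Proof.
by apply: measurable_funM => //; apply: (measurable_increment hX) => //; exact: ltW.
Qed.

Let mcos k : measurable_fun setT (fun w => cos ((k.*2.+1)%:R * th w)).
Proof. exact: (measurableT_comp (measurable_cos_scale _) mth). Qed.

(** The frequency of each term is an odd multiple of [pi / (2 * a)], hence its cosine vanishes at
    [a] and [stays_inside_cosine] evaluates it. Integrability is carried along because linearity at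
    the next index requires it. *)
Lemma Rintegral_abel_sum r M :
  P.-integrable setT (EFin \o (fun w => abel_sum (th w) r M * \1_S w)) /\
  \int[P]_w (abel_sum (th w) r M * \1_S w) = exit_sum r M v.
Proof.
have iterm k : P.-integrable setT
   (EFin \o (fun w => cos ((k.*2.+1)%:R * th w) * \1_S w)).
  apply: (@bounded_integrable _ _ _ _ _ 1).
    by apply: measurable_funM => //; exact/measurable_indic.
  move=> w; rewrite normrM -[leRHS]mulr1 ler_pM ?cos_max //.
  by rewrite indicE; case: (_ \in _); rewrite ?normr1 ?normr0.
have intterm k : \int[P]_w (cos ((k.*2.+1)%:R * th w) * \1_S w) =
    expR (- ((k.*2.+1)%:R ^+ 2 * v)).
  transitivity (expR (- (t * ((k.*2.+1)%:R * (pi / (2 * a))) ^+ 2)) : R); last first.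
    by congr expR; rewrite /v; field; rewrite gt_eqF.
  rewrite -(stays_inside_cosine hX (ltW t0) a0).
  - by apply: eq_Rintegral => w _; rewrite /th mulrA.
  - by rewrite mulr_ge0 // divr_ge0 ?pi_ge0 // mulr_ge0 // ltW.
  - rewrite -mulrA (_ : pi / (2 * a) * a = pi / 2) ?cos_odd_pihalf //.
    by field; rewrite gt_eqF.
have E0 : \int[P]_w (0 : R) = 0 by rewrite /Rintegral integral0.
elim: M => [|M [iM ih]].
  have e0 w : abel_sum (th w) r 0 * \1_S w = 0 by rewrite /abel_sum big_ord0 mul0r.
  split; last by under eq_Rintegral do rewrite e0; rewrite E0 /exit_sum big_ord0.
  by under eq_fun do rewrite /comp e0; exact: integrable0.
pose c : R := r ^+ M.*2.+1 / (M.*2.+1)%:R * (-1) ^+ M.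
have eS w : abel_sum (th w) r M.+1 * \1_S w =
    abel_sum (th w) r M * \1_S w + c * (cos ((M.*2.+1)%:R * th w) * \1_S w).
  by rewrite /abel_sum big_ord_recr /= /c; ring.
have ic : P.-integrable setT
    (EFin \o (fun w => c * (cos ((M.*2.+1)%:R * th w) * \1_S w))).
  exact: (integrableZl measurableT c (iterm M)).
split.
  have := integrableD measurableT iM ic.
  by apply: eq_integrable => // w _ /=; rewrite eS.
under eq_Rintegral do rewrite eS.
rewrite RintegralD // ih RintegralZl // intterm /exit_sum big_ord_recr /=.
by rewrite /exit_term /c; congr (_ + _); ring.
Qed.

Let mabel r M : measurable_fun setT (fun w => abel_sum (th w) r M).
Proof. by apply: measurable_sum => k; apply: measurable_funM => //; exact: measurable_funM. Qed.

Let atan_bound (y : R) : `|2^-1 * atan y| <= pi / 4.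
Proof.
rewrite normrM ger0_norm //.
have h : `|atan y| < pi / 2 by rewrite ltr_norml atan_gtNpi2 atan_ltpi2.
by lra.
Qed.

Let mabel_limit r :
  measurable_fun setT (fun w => 2^-1 * atan (2 * r * cos (th w) / (1 - r ^+ 2)) * \1_S w).
Proof.
apply: measurable_funM; last exact/measurable_indic.
apply: measurable_funM => //; apply: (measurableT_comp (f := @atan R)).
  by apply: continuous_measurable_fun => y; exact: continuous_atan.
apply: measurable_funM => //; apply: measurable_funM => //.
apply: (measurableT_comp (f := @cos R)) => //.
by apply: continuous_measurable_fun; exact: continuous_cos.
Qed.

Let abel_limit_bound r w :
  `|2^-1 * atan (2 * r * cos (th w) / (1 - r ^+ 2)) * \1_S w| <= pi / 4.
Proof.
rewrite normrM -[leRHS]mulr1 ler_pM // indicE.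
by case: (_ \in _); rewrite ?normr1 ?normr0.
Qed.

(** Go up to an index [M] so large that the Abel remainder is negligible for this [r], then return
    to [N] by the tail bound. The result is uniform in [r]. *)
Lemma exit_probability_abel N r : 0 <= r < 1 ->
  `|\int[P]_w (2^-1 * atan (2 * r * cos (th w) / (1 - r ^+ 2)) * \1_S w) -
    exit_sum r N v| <= exit_tail N v.
Proof.
move=> r01; have /andP[r0 r1] := r01.
have v0 : 0 < v by rewrite /v mulr_gt0 ?divr_gt0 ?exprn_gt0 ?divr_gt0 ?pi_gt0.
apply/ler_addgt0Pl => e e0.
have r21 : r ^+ 2 < 1 by rewrite expr_lt1.
have : geometric (2 / (1 - r ^+ 2) ^+ 2) (r ^+ 2) n @[n --> \oo] --> (0 : R).
  by apply: cvg_geometric; rewrite ger0_norm ?sqr_ge0.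
move=> /cvgrPdist_le /(_ e e0) [M0 _ hM].
(* [M0] makes the Abel remainder at most [e]; [N <= M] is what [exit_sum_cauchy] asks for. *)
pose M := maxn M0 N.
have := hM M (leq_maxl _ _); rewrite sub0r normrN => hMe.
have {}hMe : 2 * (r ^+ 2) ^+ M / (1 - r ^+ 2) ^+ 2 <= e.
  by apply: le_trans hMe; rewrite mulrAC ler_norm.
have c1 : `|\int[P]_w (2^-1 * atan (2 * r * cos (th w) / (1 - r ^+ 2)) * \1_S w) -
    exit_sum r M v| <= e.
  have [iM <-] := Rintegral_abel_sum r M.
  rewrite -RintegralB //; last first.
    exact: bounded_integrable (mabel_limit r) (abel_limit_bound r).
  apply: Rintegral_norm_le => [|w].
    by apply: measurable_funB => //; apply: measurable_funM => //; exact/measurable_indic.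
  rewrite -mulrBl normrM -[leRHS]mulr1 ler_pM //.
    rewrite distrC; exact: le_trans (abel_sum_atan _ _ r01) hMe.
  by rewrite indicE; case: (_ \in _); rewrite ?normr1 ?normr0.
rewrite (le_trans (ler_distD (exit_sum r M v) _ _)) // lerD //.
by apply: exit_sum_cauchy => //; [rewrite r0 ltW|exact: leq_maxr].
Qed.

(** Let [r] tend to 1: on [S] the cosine of [th] is positive, so the argument of the arctangent
    tends to infinity and the integrand to [pi / 4]. *)
Lemma exit_probability_bound N :
  `|pi / 4 * fine (P S) - exit_sum 1 N v| <= exit_tail N v.
Proof.
pose r (n : nat) : R := 1 - n.+2%:R^-1.
have r01 n : 0 <= r n < 1.
  by rewrite subr_ge0 invf_le1 ?ler1n //= gtrBl invr_gt0.
have cr : r n @[n --> \oo] --> (1 : R).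
  rewrite -[X in _ --> X]subr0; apply: cvgB; first exact: cvg_cst.
  by have := @cvg_harmonic R; rewrite -cvg_shiftS.
have cs : exit_sum (r n) N v @[n --> \oo] --> exit_sum 1 N v.
  rewrite /exit_sum; elim: N => [|N ih].
    by under eq_fun do rewrite big_ord0; rewrite big_ord0; exact: cvg_cst.
  under eq_fun do rewrite big_ord_recr /=.
  rewrite big_ord_recr /=; apply: cvgD => //.
  rewrite /exit_term; apply: cvgMr_tmp; apply: cvgMr_tmp.
  exact: (cvg_comp _ _ cr (@exprn_continuous R _ 1)).
have ci : \int[P]_w (2^-1 * atan (2 * r n * cos (th w) / (1 - r n ^+ 2)) * \1_S w)
    @[n --> \oo] --> pi / 4 * fine (P S).
  have -> : pi / 4 * fine (P S) = \int[P]_w (pi / 4 * \1_S w).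
    rewrite RintegralZl //; last exact: integrable_indic.
    by rewrite /Rintegral integral_indic // setIT.
  apply: (@bounded_cvg_Rintegral _ _ _ _ _ _ (pi / 4)) => //.
    by apply: measurable_funM => //; exact/measurable_indic.
  move=> w; rewrite indicE; have [/set_mem Sw|_] := boolP (w \in S); last first.
    rewrite mulr0; under eq_fun do rewrite mulr0; exact: cvg_cst.
  rewrite mulr1; under eq_fun do rewrite mulr1.
  (* Index 1 at level 0 is the final time [t]; on [S] the displacement there is strictly below [a],
     so [th w] lies strictly between [- pi / 2] and [pi / 2]. *)
  have c0 : 0 < cos (th w).
    apply: cos_gt0_pihalf; have := Sw 0%N 1%N (leqnn _).
    rewrite (dyadic_max t 0) ltr_norml => /andP[h1 h2].
    have pa : 0 < pi / (2 * a) by rewrite divr_gt0 ?pi_gt0 // mulr_gt0.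
    have e : pi / 2 = pi / (2 * a) * a by field; rewrite gt_eqF.
    by rewrite e -mulrN !ltr_pM2l // h1.
  rewrite (_ : pi / 4 = 2^-1 * (pi / 2)); last by field.
  apply: cvgMl_tmp; apply: (cvg_comp _ _ _ (@cvgy_atan R)).
  apply/cvgryPge => B; exists (Num.truncn (`|B| / cos (th w))).+1 => // n /= Bn.
  have nB : B <= n.+1%:R * cos (th w).
    rewrite (le_trans (ler_norm _)) // -ler_pdivrMr //.
    rewrite (le_trans (ltW (truncnS_gt _))) // ler_nat.
    exact: leqW.
  rewrite (le_trans nB) // mulrAC ler_wpM2r ?(ltW c0) //.
  have -> : n.+1%:R = n.+2%:R - 1 :> R by rewrite -[n.+2%:R]natr1 addrK.
  rewrite /r; have : 2 <= n.+2%:R :> R by rewrite ler_nat.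
  move: (n.+2%:R) => m m2; have m0 : 0 < m by lra.
  have m3 : 0 < 2 * m - 1 by lra.
  (* With [r = 1 - m^-1] the quotient [2 r / (1 - r ^ 2)] takes this form; its last factor is at
     least 1. *)
  rewrite (_ : _ / _ = (m - 1) * (2 * m / (2 * m - 1))); last first.
    by field; rewrite (gt_eqF m0) (gt_eqF m3).
  rewrite ler_peMr ?subr_ge0 ?ler_pdivlMr //; lra.
apply: (cvgr_to_le (cvg_norm (cvgB ci cs))).
by apply: nearW => n; exact: exit_probability_abel.
Qed.

End ExitProbability.

(** * Dyadic times and the running supremum *)

Section RunningSup.
Context (d : measure_display) (T : measurableType d) (R : realType)
        (P : probability T R) (X : R -> T -> R).
Hypothesis hX : wiener_process P X.

Lemma running_sup_le t w (x : R) :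
  (running_sup X t w <= x%:E)%E <-> forall tau, 0 <= tau <= t -> `|X tau w| <= x.
Proof.
split=> [h tau tt|h].
  rewrite -lee_fin; apply: le_trans h; apply: ereal_sup_ubound.
  by exists tau => //=; rewrite in_itv.
apply: ge_ereal_sup => _ [tau /= + <-]; rewrite in_itv /= lee_fin; exact: h.
Qed.

Lemma running_sup_ge0 t w : 0 <= t -> (0 <= running_sup X t w)%E.
Proof.
move=> t0; apply: (@le_trans _ _ (`|X 0 w|)%:E); first by rewrite lee_fin.
by apply: ereal_sup_ubound; exists 0 => //=; rewrite in_itv /= lexx.
Qed.

(** A continuous path above [x] at some time is above [x] at nearby dyadic times too. Only the weak
    inequality passes to the limit. *)
Lemma dyadic_dense t w (x : R) : 0 < t ->
  (forall m k, (k <= 2 ^ m)%N -> `|X (dyadic t m k) w| <= x) ->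
  forall tau, 0 <= tau <= t -> `|X tau w| <= x.
Proof.
move=> t0 h tau /andP[tau0 taut]; rewrite leNgt; apply/negP => xlt.
have cX : {within `[0, t], continuous (X ^~ w)}.
  apply: continuous_subspaceW (@wiener_continuous _ _ _ _ _ hX w).
  by move=> y /=; rewrite !in_itv /= => /andP[-> _].
have e0 : 0 < `|X tau w| - x by rewrite subr_gt0.
have [r r0 hr] := within_segment_unif_continuous cX e0.
have : geometric t 2^-1 n @[n --> \oo] --> (0 : R).
  by apply: cvg_geometric; rewrite gtr0_norm ?invf_lt1 ?ltr1n.
move=> /cvgrPdist_lt /(_ r r0) [m _ /(_ m (leqnn _))] /=.
rewrite sub0r normrN exprVn ger0_norm; last by rewrite divr_ge0 ?exprn_ge0 // ltW.
(* The index of the last grid time not after [tau], which is less than one mesh away. *)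
move=> tmr; pose k := Num.truncn (tau / t * 2 ^+ m).
have k0 : 0 <= tau / t * 2 ^+ m by rewrite mulr_ge0 ?exprn_ge0 // divr_ge0 // ltW.
have /andP[kle klt] : k%:R <= tau / t * 2 ^+ m < k.+1%:R by exact: truncn_itv.
have p0 : 0 < 2 ^+ m :> R by rewrite exprn_gt0.
have km : (k <= 2 ^ m)%N.
  rewrite -(ler_nat R) (le_trans kle) // natrX ler_piMl ?(ltW p0) //.
  by rewrite ler_pdivrMr // mul1r.
have tauE : tau = tau / t * 2 ^+ m * (t / 2 ^+ m).
  by field; rewrite (gt_eqF t0) (gt_eqF p0).
have dyE : dyadic t m k = k%:R * (t / 2 ^+ m) by rewrite /dyadic mulrCA.
have dt0 : 0 < t / 2 ^+ m by rewrite divr_gt0.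
have dle : dyadic t m k <= tau by rewrite dyE tauE ler_pM2r.
have dgt : tau - dyadic t m k < r.
  apply: lt_trans tmr; rewrite [X in X - _]tauE dyE -mulrBl gtr_pMl //.
  by rewrite ltrBlDr nat1r.
have := hr tau (dyadic t m k).
rewrite !in_itv /= tau0 taut dyadic_ge0 ?(ltW t0) //= (le_trans dle taut).
move=> /(_ isT isT); rewrite ger0_norm ?subr_ge0 // => /(_ dgt).
have := h m k km; have := ler_dist_dist (X tau w) (X (dyadic t m k) w).
move=> h1 h2 h3; have := le_lt_trans (ler_norm _) (le_lt_trans h1 h3).
by lra.
Qed.

Definition dyadic_inside (t a : R) : set T :=
  [set w | forall m k, (k <= 2 ^ m)%N -> `|X (dyadic t m k) w| < a].

(* A path may touch the level [a] between dyadic times, so that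
   [dyadic_inside t a] is larger than the event [running_sup < a]; the latter
   is recovered as an increasing union over the levels [shrink a n]. *)
Definition shrink (a : R) (n : nat) : R := a * (1 - n.+2%:R^-1).

Lemma shrink_gt0 a n : 0 < a -> 0 < shrink a n.
Proof. by move=> a0; rewrite mulr_gt0 // subr_gt0 invf_lt1 ?ltr1n. Qed.

Lemma shrink_lt a n : 0 < a -> shrink a n < a.
Proof. by move=> a0; rewrite gtr_pMr // gtrBl invr_gt0. Qed.

Lemma shrink_cvg a : shrink a n @[n --> \oo] --> a.
Proof.
rewrite -[X in _ --> X]mulr1; apply: cvgMl_tmp.
rewrite -[X in _ --> X]subr0; apply: cvgB; first exact: cvg_cst.
by have := @cvg_harmonic R; rewrite -cvg_shiftS.
Qed.

Lemma shrink_homo a : 0 < a -> {homo shrink a : m n / (m <= n)%N >-> m <= n}.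
Proof.
move=> a0 m n mn; rewrite ler_pM2l // lerD2l lerN2 lef_pV2 ?posrE //.
by rewrite ler_nat.
Qed.

Lemma running_sup_lt_bigcup t a : 0 < t -> 0 < a ->
  [set w | (running_sup X t w < a%:E)%E] = \bigcup_n dyadic_inside t (shrink a n).
Proof.
move=> t0 a0; apply/seteqP; split=> w /=.
  move=> sa; have s0 := running_sup_ge0 w (ltW t0).
  have sf : running_sup X t w \is a fin_num.
    by rewrite ge0_fin_numE // (lt_trans sa) // ltry.
  move: sa; rewrite -(fineK sf) lte_fin => sa.
  have /cvgrPdist_lt /(_ (a - fine (running_sup X t w))) := @shrink_cvg a.
  rewrite subr_gt0 => /(_ sa) [n _ /(_ n (leqnn _))] /= hn.
  exists n => // m k km.
  have hs : `|X (dyadic t m k) w| <= fine (running_sup X t w).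
    move: (dyadic t m k) (dyadic_ge0 m k (ltW t0)) (dyadic_le (ltW t0) km) => y y0 yt.
    by apply: (proj1 (running_sup_le t w _)); rewrite ?fineK // y0.
  have := ler_norm (a - shrink a n); lra.
move=> [n _ h]; have : (running_sup X t w <= (shrink a n)%:E)%E.
  apply/running_sup_le/dyadic_dense => // m k km; exact/ltW/h.
by move=> /le_lt_trans; apply; rewrite lte_fin shrink_lt.
Qed.

End RunningSup.

(** * The estimate for the law of the running supremum *)

Section ExitTimeLaw.
Context (d : measure_display) (T : measurableType d) (R : realType)
        (P : probability T R) (X : R -> T -> R).
Hypothesis hX : wiener_process P X.

Lemma measurable_dyadic_inside t a : 0 <= t -> measurable (dyadic_inside X t a).
Proof.
move=> t0; rewrite (_ : dyadic_inside X t a =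
  \bigcap_m \bigcap_(k in [set k | (k <= 2 ^ m)%N])
    (fun w => `|X (dyadic t m k) w|) @^-1` `]-oo, a[%classic); last first.
  apply/seteqP; split=> w h m; first by move=> _ k km /=; rewrite in_itv; exact: h.
  by move=> k km; have := h m I k km; rewrite /= in_itv.
apply: bigcap_measurableType => m _; apply: bigcap_measurableType => k _.
rewrite -[X in measurable X]setTI.
have : measurable_fun setT (fun w => `|X (dyadic t m k) w|).
  by apply: measurableT_comp => //; exact/(wiener_measurable hX)/dyadic_ge0.
by apply.
Qed.

Lemma measurable_running_sup_lt t a : 0 < t -> 0 < a ->
  measurable [set w | (running_sup X t w < a%:E)%E].
Proof.
move=> t0 a0; rewrite (running_sup_lt_bigcup hX) //.
by apply: bigcup_measurable => n _; exact/measurable_dyadic_inside/ltW.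
Qed.

Lemma measurable_start : measurable [set w | X 0 w = 0].
Proof.
have := wiener_measurable hX (lexx 0) measurableT (measurable_set1 (0 : R)).
by rewrite setTI.
Qed.

Lemma start_full : P (~` [set w | X 0 w = 0]) = 0%E.
Proof.
have := wiener_start hX => ae; apply/(negligibleP P _); last exact: ae.
exact/measurableC/measurable_start.
Qed.

Let start := [set w | X 0 w = 0].

Let mstart : measurable start := measurable_start.

Let eq_on_start (A B : set T) : measurable A -> measurable B ->
  A `&` start = B `&` start -> P A = P B.
Proof.
have split_start (C : set T) : measurable C -> P C = P (C `&` start).
  move=> mC; rewrite (measureDI P mC mstart) [X in (X + _)%E](_ : _ = 0%E) ?add0e //.
  apply/eqP; rewrite eq_le measure_ge0 andbT -start_full.
  by apply: le_measure; rewrite ?inE; [exact: measurableD|exact: measurableC|move=> w []].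
by move=> mA mB AB; rewrite split_start // AB -split_start.
Qed.

(** The two events agree where [X 0 = 0], a set of full measure. *)
Lemma dyadic_inside_stays_inside t a : 0 <= t ->
  P (dyadic_inside X t a) = P (stays_inside X t a).
Proof.
move=> t0; apply: eq_on_start.
- exact: measurable_dyadic_inside.
- exact: (measurable_stays_inside hX).
- apply/seteqP; split=> w [h s0]; split=> // m k km.
    by rewrite s0 subr0; exact: h.
  by have := h m k km; rewrite s0 subr0.
Qed.

(** Continuity from below along the levels [shrink a n], whose events increase to
    [running_sup < a]. *)
Lemma p2_cvg t a : 0 < t -> 0 < a ->
  fine (P (stays_inside X t (shrink a n))) @[n --> \oo] --> p2 P X t a.
Proof.
move=> t0 a0; have md n := measurable_dyadic_inside (shrink a n) (ltW t0).
under eq_fun do rewrite -dyadic_inside_stays_inside ?(ltW t0) //.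
apply: fine_cvg; rewrite fineK.
  rewrite (running_sup_lt_bigcup hX) //; apply: nondecreasing_cvg_mu => //.
    exact: bigcup_measurable.
  move=> m n mn; apply/subsetPset => w h j k jk.
  exact: lt_le_trans (h j k jk) (shrink_homo a0 mn).
by apply: fin_num_measure; exact: measurable_running_sup_lt.
Qed.

Lemma expR_scale_continuous (c v : R) :
  expR (- (c * x)) @[x --> v] --> (expR (- (c * v)) : R).
Proof.
have h : - (c * x) @[x --> v] --> - (c * v).
  by apply: (@cvgN _ R^o); apply: cvgMl_tmp; exact: cvg_id.
exact: (cvg_comp _ _ h (@continuous_expR R _)).
Qed.

Lemma exit_sum_continuous N (v : R) : exit_sum 1 N x @[x --> v] --> exit_sum 1 N v.
Proof.
rewrite /exit_sum; elim: N => [|N ih].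
  by under eq_fun do rewrite big_ord0; rewrite big_ord0; exact: cvg_cst.
under eq_fun do rewrite big_ord_recr /=.
rewrite big_ord_recr /=; apply: cvgD => //.
rewrite /exit_term; apply: cvgMl_tmp; apply: cvgMl_tmp.
exact: expR_scale_continuous.
Qed.

Lemma exit_tail_continuous N (v : R) : 0 < v ->
  exit_tail N x @[x --> v] --> exit_tail N v.
Proof.
move=> v0; have c8 := @expR_scale_continuous 8 v.
have c1 : expR (- x) @[x --> v] --> (expR (- v) : R).
  have := @expR_scale_continuous 1 v.
  by under eq_fun do rewrite mul1r; rewrite mul1r.
apply: cvgM; first by apply: cvgM c1 (cvg_comp _ _ c8 (@exprn_continuous R _ _)).
apply: cvgV; last by apply: cvgB => //; exact: cvg_cst.
by rewrite subr_eq0 eq_sym lt_eqF // expR_lt1 oppr_lt0 mulr_gt0.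
Qed.

(** The estimate from which scaling, decay and continuity of [p2] are drawn. It holds at each level
    [shrink a n], and sum and tail are continuous in the exponent, so it survives as the level tends
    to [a]. *)
Lemma p2_bound t a N : 0 < t -> 0 < a ->
  `|pi / 4 * p2 P X t a - exit_sum 1 N (t / a ^+ 2 * (pi / 2) ^+ 2)|
  <= exit_tail N (t / a ^+ 2 * (pi / 2) ^+ 2).
Proof.
move=> t0 a0; set v := t / a ^+ 2 * (pi / 2) ^+ 2.
have v0 : 0 < v by rewrite /v mulr_gt0 ?divr_gt0 ?exprn_gt0 ?divr_gt0 ?pi_gt0.
pose vn n := t / shrink a n ^+ 2 * (pi / 2) ^+ 2.
have cv : vn n @[n --> \oo] --> v.
  apply: cvgMr_tmp; apply: cvgMl_tmp; apply: cvgV; first by rewrite expf_neq0 // gt_eqF.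
  exact: (cvg_comp _ _ (@shrink_cvg _ a) (@exprn_continuous R _ _)).
have cs := cvg_comp _ _ cv (@exit_sum_continuous N v).
have ct := cvg_comp _ _ cv (@exit_tail_continuous N v v0).
have cp : pi / 4 * fine (P (stays_inside X t (shrink a n))) @[n --> \oo] -->
    pi / 4 * p2 P X t a.
  by apply: cvgMl_tmp; exact: p2_cvg.
apply: (ler_cvg_to (cvg_norm (cvgB cp cs)) ct).
apply: nearW => n; exact: (exit_probability_bound hX t0 (shrink_gt0 n a0)).
Qed.

End ExitTimeLaw.

(** * The Green operator *)

Section GreenEquation.
Variable R : realType.
Notation mu := (@lebesgue_measure R).
Implicit Types (a x y kappa : R) (f G : R -> R).

Lemma derive0_constant_segment G a b : {within `[a, b], continuous G} ->
  (forall x, x \in `]a, b[ -> is_derive x 1 G 0) ->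
  forall x, x \in `[a, b] -> G x = G a.
Proof.
move=> cG dG x; rewrite in_itv /= => /andP[ax xb].
have [|| y _] := @MVT_segment _ G (fun=> 0) a x ax.
- move=> y; rewrite in_itv /= => /andP[ay yx]; apply: dG.
  by rewrite in_itv /= ay (lt_le_trans yx).
- apply: continuous_subspaceW cG => y /=; rewrite !in_itv /= => /andP[-> yx].
  exact: le_trans xb.
- by rewrite mul0r => /eqP; rewrite subr_eq0 => /eqP.
Qed.

Section Potential.
Variables (a : R) (f : R -> R).
Hypothesis a0 : 0 < a.
Hypothesis Lf : L2 a f.

Let aa : - a <= a.
Proof. by apply: (@le_trans _ _ 0); rewrite ?oppr_le0 ltW. Qed.

Let fD := f \_ `]- a, a[.

Let F0 x := \int[mu]_(t in `[- a, x]) fD t.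
Let F1 x := \int[mu]_(t in `[- a, x]) (t * fD t).
Let K := (2 * a)^-1 * \int[mu]_t ((a - t) * fD t).

(** Variation of constants for [W'' = - f], [W (- a) = 0], split into the primitives [F0] and [F1]
    so that the fundamental theorem of calculus applies to each. [K] is the initial slope that makes
    [W a = 0]. *)
Definition green_potential x : R := F1 x - x * F0 x + (a + x) * K.
Definition green_slope x : R := K - F0 x.

Let ifD : mu.-integrable setT (EFin \o fD) := L2_patch_integrable Lf.

Let mfD : measurable_fun setT fD.
Proof. by case/integrableP: ifD => /measurable_EFinP. Qed.

Let itfD : mu.-integrable setT (EFin \o (fun t => t * fD t)).
Proof.
have := integrableZl measurableT a ifD; apply: le_integrable => //.
  by apply/measurable_EFinP; apply: measurable_funM.
move=> t _ /=; rewrite lee_fin /fD patchE.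
case: ifPn => [|_]; last by rewrite !mulr0.
rewrite inE /= in_itv /= => /andP[t1 t2]; rewrite !normrM ler_wpM2r //.
by rewrite (gtr0_norm a0) ler_norml !ltW.
Qed.

Let F0_continuous : {within `[- a, a], continuous F0}.
Proof.
apply: (parameterized_integral_continuous aa).
by apply: (integrableS measurableT) ifD.
Qed.

Let F1_continuous : {within `[- a, a], continuous F1}.
Proof.
apply: (parameterized_integral_continuous aa).
by apply: (integrableS measurableT) itfD.
Qed.

Let fD_out t : t \notin `]- a, a[ -> fD t = 0.
Proof. by move=> tn; rewrite /fD patchE; case: ifPn => //; rewrite inE /= (negbTE tn). Qed.

Lemma green_potential_left : green_potential (- a) = 0.
Proof.
by rewrite /green_potential /F0 /F1 !set_itv1 !Rintegral_set1; ring.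
Qed.

Let integral_segment (g : R -> R) : (forall t, t \notin `]- a, a[ -> g t = 0) ->
  \int[mu]_(t in `[- a, a]) g t = \int[mu]_t g t.
Proof.
move=> g0; rewrite Rintegral_mkcond; apply: eq_Rintegral => t _.
rewrite patchE; case: ifPn => // tn; rewrite g0 //.
apply: contra tn; rewrite inE /= !in_itv /= => /andP[h1 h2].
by rewrite !ltW.
Qed.

Let integral_aB : \int[mu]_t ((a - t) * fD t) = a * F0 a - F1 a.
Proof.
rewrite /F0 /F1 !integral_segment; last 2 first.
- by move=> t tn; rewrite fD_out ?mulr0.
- exact: fD_out.
rewrite -RintegralZl // -RintegralB //; last first.
  exact: (integrableZl measurableT a ifD).
by apply: eq_Rintegral => t _; rewrite mulrBl.
Qed.

Lemma green_potential_right : green_potential a = 0.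
Proof.
by rewrite /green_potential /K integral_aB; field; rewrite gt_eqF.
Qed.

(* [Phi2 x y a] is [(a - y) (a + x) / (2 a)] minus the positive part of
   [x - y]. *)
Lemma B2_green_potential x : x \in `]- a, a[ -> B2 a f x = green_potential x.
Proof.
rewrite in_itv /= => /andP[x1 x2].
have i1 : mu.-integrable setT (EFin \o (fun t => (a - t) * fD t)).
  have := integrableB measurableT (integrableZl measurableT a ifD) itfD.
  by apply: eq_integrable => // t _ /=; rewrite mulrBl EFinB.
pose p t := if t <= x then (x - t) * fD t else 0.
have i2 : mu.-integrable setT (EFin \o p).
  have := integrableZl measurableT (2 * a) ifD; apply: le_integrable => //.
    apply/measurable_EFinP; apply: measurable_fun_ifT => //.
      exact: measurable_fun_ler.
    by apply: measurable_funM => //; exact: measurable_funB.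
  move=> t _ /=; rewrite lee_fin /p; case: ifPn => [tx|_]; last by rewrite normr0.
  rewrite [leLHS]normrM [leRHS]normrM.
  have [ta|/fD_out ->] := boolP (t \in `]- a, a[); last first.
    by rewrite normr0 !mulr0.
  move: ta; rewrite in_itv /= => /andP[t1 t2]; rewrite ler_wpM2r //.
  rewrite !ger0_norm ?subr_ge0 ?mulr_ge0 ?(ltW a0) //.
  by rewrite mulr_natl mulr2n lerD ?(ltW x2) // lerNl ltW.
transitivity (\int[mu]_t ((a + x) / (2 * a) * ((a - t) * fD t) - p t)).
  rewrite /B2 Rintegral_mkcond; apply: eq_Rintegral => t _; rewrite /p patchE mem_setE.
  have [ta|tn] := boolP (t \in `]- a, a[); last first.
    by rewrite fD_out //; case: ifP => _; rewrite !mulr0 subr0.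
  rewrite /fD patchE mem_setE ta /Phi2; case: ifP => _; field; rewrite gt_eqF //.
rewrite RintegralB //; last exact: (integrableZl measurableT _ i1).
rewrite RintegralZl //.
have -> : \int[mu]_t p t = x * F0 x - F1 x.
  rewrite /F0 /F1 -RintegralZl //; last by apply: (integrableS measurableT) ifD.
  rewrite -RintegralB //; last 2 first.
  - by apply: (integrableS measurableT) (integrableZl measurableT x ifD).
  - by apply: (integrableS measurableT) itfD.
  rewrite [RHS]Rintegral_mkcond; apply: eq_Rintegral => t _; rewrite /p patchE mem_setE.
  have [ta|tn] := boolP (t \in `]- a, a[); last first.
    by rewrite fD_out //; case: ifP => _; case: ifP => _; rewrite ?mulr0 ?subr0.
  have t1 : - a <= t by move: ta; rewrite in_itv /= => /andP[/ltW].
  by rewrite in_itv /= t1 /=; case: ifP => _ //; rewrite mulrBl.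
by rewrite /green_potential /K; field; rewrite gt_eqF.
Qed.

Lemma green_potential_continuous : {within `[- a, a], continuous green_potential}.
Proof.
move=> x; apply: cvgD.
  apply: cvgB; first exact: F1_continuous.
  apply: cvgM; last exact: F0_continuous.
  by apply: continuous_subspaceT; move=> y; exact: cvg_id.
apply: cvgMr_tmp; apply: cvgD; first exact: cvg_cst.
by apply: continuous_subspaceT; move=> y; exact: cvg_id.
Qed.

Lemma green_slope_continuous : {within `[- a, a], continuous green_slope}.
Proof. by move=> x; apply: cvgB; [exact: cvg_cst|exact: F0_continuous]. Qed.

(** Regularity bootstrap: [f] is only square integrable, but [B2 a f] is continuous, and the
    pointwise equation passes this on to [f]. The term [k] is 0 for eigenfunctions and the Green
    function at 0 for the resolvent. *)
Lemma green_continuous (k : R -> R) kappa : continuous k ->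
  (forall x, x \in `]- a, a[ -> f x = k x + kappa * B2 a f x) ->
  forall x, x \in `]- a, a[ -> {for x, continuous f}.
Proof.
move=> ck fE x xa.
have aa' : - a < a by move: xa; rewrite in_itv /= => /andP[]; exact: lt_trans.
have fWE y : y \in `]- a, a[ -> f y = k y + kappa * green_potential y.
  by move=> ya; rewrite fE // B2_green_potential.
have cW : {for x, continuous green_potential}.
  by have /(continuous_within_itvP _ aa') [cW _ _] := green_potential_continuous; exact: cW.
have : k y + kappa * green_potential y @[y --> x] --> k x + kappa * green_potential x.
  by apply: cvgD; [exact: ck|apply: cvgMl_tmp; exact: cW].
rewrite -(fWE x xa); apply: cvg_trans; apply: near_eq_cvg.
near=> y; rewrite fWE //.
by near: y; exact: near_in_itvoo.
Unshelve. all: end_near. Qed.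

Lemma green_ode x : x \in `]- a, a[ -> {for x, continuous f} ->
  is_derive x 1 green_potential (green_slope x) /\
  is_derive x 1 green_slope (- f x).
Proof.
move=> xa cf; have /andP[x1 x2] : - a < x < a by move: xa; rewrite in_itv.
have fDE y : y \in `]- a, a[ -> fD y = f y by move=> ya; rewrite /fD patchE mem_setE ya.
have cfD : {for x, continuous fD}.
  move: cf; rewrite /prop_for /continuous_at -(fDE x xa); apply: cvg_trans.
  apply: near_eq_cvg; near=> y; rewrite fDE //.
  by near: y; exact: near_in_itvoo.
have dF0 : is_derive x 1 F0 (fD x).
  have iS : mu.-integrable `[- a, a] (EFin \o fD).
    by apply: (integrableS measurableT) ifD.
  have [d1 d2] := continuous_FTC1_closed x2 iS x1 cfD.
  by have := derivableP d1; rewrite -derive1E d2.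
have dF1 : is_derive x 1 F1 (x * fD x).
  have iS : mu.-integrable `[- a, a] (EFin \o (fun t => t * fD t)).
    by apply: (integrableS measurableT) itfD.
  have ctfD : {for x, continuous (fun t : R => t * fD t)}.
    by apply: cvgM; [exact: cvg_id|exact: cfD].
  have [d1 d2] := continuous_FTC1_closed x2 iS x1 ctfD.
  by have := derivableP d1; rewrite -derive1E d2.
split.
  rewrite /green_potential (_ : (fun _ => _) = F1 - (id : R -> R) * F0 +
    (cst (a * K) + K *: (id : R -> R))); last first.
    by apply/funext => y; rewrite !fctE /GRing.scale /=; ring.
  apply: (is_derive_eq (is_deriveD
    (is_deriveB dF1 (is_deriveM (is_derive_id x 1) dF0))
    (is_deriveD (is_derive_cst _ _ _) (is_deriveZ K (is_derive_id x 1))))).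
  by rewrite /GRing.scale /= /green_slope; ring.
rewrite /green_slope (_ : (fun _ => _) = cst K - F0) //.
apply: (is_derive_eq (is_deriveB (is_derive_cst _ _ _) dF0)).
by rewrite sub0r fDE.
Unshelve. all: end_near. Qed.

End Potential.
End GreenEquation.

(** * Uniqueness for the hyperbolic boundary value problem *)

Section LinearODE.
Variable R : realType.
Implicit Types (W V : R -> R) (a p q x y : R).

Lemma is_derive_mull (p y : R) : is_derive y 1 (fun z : R => p * z) p.
Proof.
apply: (is_derive_eq (is_deriveZ p (is_derive_id y 1))).
by rewrite /GRing.scale /= mulr1.
Qed.

(* [V - p W] and [V + p W] diagonalize the system [W' = V, V' = p ^ 2 W]. *)
Lemma hyperbolic_invariant W V a p : 0 < a -> {within `[- a, a], continuous W} ->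
  {within `[- a, a], continuous V} -> W (- a) = 0 ->
  (forall x, x \in `]- a, a[ ->
     is_derive x 1 W (V x) /\ is_derive x 1 V (p ^+ 2 * W x)) ->
  forall x, x \in `[- a, a] ->
  (V x - p * W x) * expR (p * x) = V (- a) * expR (- (p * a)).
Proof.
move=> a0 cW cV Wl dWV x xa.
rewrite (@derive0_constant_segment _ (fun x => (V x - p * W x) * expR (p * x))
  (- a) a _ _ x xa); first by rewrite Wl mulr0 subr0 mulrN.
  move=> y; apply: cvgM.
    by apply: cvgB; [exact: cV|apply: cvgMl_tmp; exact: cW].
  apply: continuous_subspaceT => z.
  apply: (cvg_comp (fun z => p * z) (@expR R) _ (@continuous_expR R _)).
  by apply: cvgMl_tmp; exact: cvg_id.
move=> y /dWV [dW dV].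
have de : is_derive y 1 (fun z : R => expR (p * z)) (p * expR (p * y)).
  have := is_derive1_comp (is_derive_expR _) (is_derive_mull p y).
  by rewrite mulrC.
apply: (is_derive_eq (is_deriveM (is_deriveB dV (is_deriveZ p dW)) de)).
rewrite /GRing.scale /= ?fctE.
by rewrite /GRing.scale_fun /GRing.scale /=; ring.
Qed.

(** The invariants for [p] and [- p], read at [a] where [W] vanishes, give
    [V (- a) * (1 - expR (p * a) ^+ 4) = 0]. So [V (- a) = 0], both invariants are 0, and
    [V + p W = V - p W = 0] everywhere. *)
Lemma hyperbolic_unique W V a p : 0 < a -> 0 < p ->
  {within `[- a, a], continuous W} -> {within `[- a, a], continuous V} ->
  W (- a) = 0 -> W a = 0 ->
  (forall x, x \in `]- a, a[ ->
     is_derive x 1 W (V x) /\ is_derive x 1 V (p ^+ 2 * W x)) ->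
  forall x, x \in `[- a, a] -> W x = 0.
Proof.
move=> a0 p0 cW cV Wl Wr dWV x xa.
have e1 := hyperbolic_invariant a0 cW cV Wl dWV.
have e2 : forall x, x \in `[- a, a] ->
    (V x - - p * W x) * expR (- p * x) = V (- a) * expR (- (- p * a)).
  by apply: hyperbolic_invariant => //; rewrite sqrrN.
have right_in : a \in `[- a, a].
  by rewrite in_itv /= lexx andbT (@le_trans _ _ 0) ?oppr_le0 ?ltW.
have := e1 _ right_in; have := e2 _ right_in; rewrite !Wr !mulr0 !subr0.
rewrite !mulNr opprK => r2 r1.
have Vl : V (- a) = 0.
  have h1 : V (- a) = V a * expR (p * a) * expR (p * a).
    by rewrite r1 -mulrA -expRD addNr expR0 mulr1.
  have h2 : V (- a) * expR (p * a) * expR (p * a) = V a.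
    by rewrite -r2 -mulrA -expRD addNr expR0 mulr1.
  have ep : 1 < expR (p * a) by rewrite expR_gt1 mulr_gt0.
  move: h1; rewrite -h2 => /eqP; rewrite -subr_eq0.
  set e := expR _ in ep *.
  rewrite (_ : _ - _ = V (- a) * (1 - e ^+ 4)); last by ring.
  rewrite mulf_eq0 => /orP[/eqP //|]; rewrite subr_eq0 eq_sym gt_eqF //.
  by rewrite exprn_egt1.
have := e1 x xa; have := e2 x xa; rewrite Vl !mul0r.
move=> /eqP; rewrite mulf_eq0 (gt_eqF (expR_gt0 _)) orbF mulNr opprK => /eqP u1.
move=> /eqP; rewrite mulf_eq0 (gt_eqF (expR_gt0 _)) orbF => /eqP u2.
have : p * W x = 0.
  rewrite (_ : p * W x = (V x + p * W x - (V x - p * W x)) / 2); last by field.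
  by rewrite u1 u2 subrr mul0r.
by move/eqP; rewrite mulf_eq0 gt_eqF //= => /eqP.
Qed.

End LinearODE.

(** * Positive solutions of the eigenvalue equation *)

Section GreenSolutions.
Variable R : realType.
Notation mu := (@lebesgue_measure R).
Variables (a : R) (f : R -> R).
Hypothesis a0 : 0 < a.
Hypothesis Lf : L2 a f.

Let W := green_potential a f.
Let V := green_slope a f.

Let aa : - a < a.
Proof. by apply: (@lt_trans _ _ 0); rewrite ?oppr_lt0. Qed.

Let left_in : - a \in `[- a, a].
Proof. by rewrite in_itv /= lexx ltW. Qed.

Let right_in : a \in `[- a, a].
Proof. by rewrite in_itv /= lexx ltW. Qed.

Let W_left : W (- a) = 0.
Proof. exact: green_potential_left. Qed.

Let W_right : W a = 0.
Proof. exact: green_potential_right. Qed.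

(** The vector [(q W, V)] rotates with constant angular speed [q]; [G1] and [G2] are its coordinates
    in the rotating frame, hence constant, and rotating back recovers [q W]. *)
Let rotation_invariant (q : R) :
  (forall x, x \in `]- a, a[ -> f x = q ^+ 2 * B2 a f x) ->
  exists c1 c2, forall x, x \in `[- a, a] ->
  q * W x = c1 * cos (q * x) + c2 * sin (q * x).
Proof.
move=> fE; have cf : forall x, x \in `]- a, a[ -> {for x, continuous f}.
  apply: (green_continuous a0 Lf (k := cst 0) (kappa := q ^+ 2)).
    by move=> y; exact: cvg_cst.
  by move=> y ya; rewrite add0r fE.
have dWV y : y \in `]- a, a[ ->
    is_derive y 1 W (V y) /\ is_derive y 1 V (- (q ^+ 2 * W y)).
  move=> ya; have [dW dV] := green_ode a0 Lf ya (cf y ya); split=> //.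
  by apply: (is_derive_eq dV); rewrite fE // (B2_green_potential a0 Lf).
pose G1 x := q * W x * cos (q * x) - V x * sin (q * x).
pose G2 x := q * W x * sin (q * x) + V x * cos (q * x).
have cc (g : R -> R) : continuous g -> {within `[- a, a], continuous (fun x => g (q * x))}.
  move=> cg; apply: continuous_subspaceT => z.
  apply: (cvg_comp (fun z => q * z) g _ (cg _)).
  by apply: cvgMl_tmp; exact: cvg_id.
have cW : {within `[- a, a], continuous (fun x => q * W x)}.
  by move=> y; apply: cvgMl_tmp; exact: (green_potential_continuous a0 Lf).
have cV : {within `[- a, a], continuous V} := green_slope_continuous a0 Lf.
have dc (y : R) : is_derive y 1 (fun z : R => cos (q * z)) (- sin (q * y) * q).
  exact: is_derive1_comp (is_derive_cos _) (is_derive_mull q y).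
have ds (y : R) : is_derive y 1 (fun z : R => sin (q * z)) (cos (q * y) * q).
  exact: is_derive1_comp (is_derive_sin _) (is_derive_mull q y).
have G1c x : x \in `[- a, a] -> G1 x = G1 (- a).
  apply: derive0_constant_segment.
    move=> y; apply: cvgB; apply: cvgM.
    - exact: cW.
    - exact: (cc _ (@continuous_cos R)).
    - exact: cV.
    - exact: (cc _ (@continuous_sin R)).
  move=> y /dWV [dW dV].
  apply: (is_derive_eq (is_deriveB (is_deriveM (is_deriveZ q dW) (dc y)) (is_deriveM dV (ds y)))).
  rewrite /GRing.scale /= ?fctE -/(W y) -/(V y).
  by rewrite /GRing.scale_fun /GRing.scale /= -/(W y); ring.
have G2c x : x \in `[- a, a] -> G2 x = G2 (- a).
  apply: derive0_constant_segment.
    move=> y; apply: cvgD; apply: cvgM.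
    - exact: cW.
    - exact: (cc _ (@continuous_sin R)).
    - exact: cV.
    - exact: (cc _ (@continuous_cos R)).
  move=> y /dWV [dW dV].
  apply: (is_derive_eq (is_deriveD (is_deriveM (is_deriveZ q dW) (ds y)) (is_deriveM dV (dc y)))).
  rewrite /GRing.scale /= ?fctE -/(W y) -/(V y).
  by rewrite /GRing.scale_fun /GRing.scale /= -/(W y); ring.
exists (G1 (- a)), (G2 (- a)) => x xa; rewrite -(G1c x xa) -(G2c x xa) /G1 /G2.
transitivity (q * W x * (cos (q * x) ^+ 2 + sin (q * x) ^+ 2)); last by ring.
by rewrite cos2Dsin2 mulr1.
Qed.

(** The boundary values, added and subtracted, give [c1 * cos (q * a) = 0] and
    [c2 * sin (q * a) = 0]. Positivity at 0 means [c1 > 0], so the cosine vanishes, the sine does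
    not, and [c2 = 0]. Positivity inside then selects the first zero of the cosine. *)
Lemma green_positive_solution (q : R) : 0 < q ->
  (forall x, x \in `]- a, a[ -> 0 < B2 a f x) ->
  (forall x, x \in `]- a, a[ -> f x = q ^+ 2 * B2 a f x) ->
  q = pi / (2 * a) /\ exists c, forall x, x \in `]- a, a[ -> f x = c * cos (q * x).
Proof.
move=> q0 Bpos fE; have [c1 [c2 Wcs]] := rotation_invariant fE.
have Wpos x : x \in `]- a, a[ -> 0 < W x.
  by move=> xa; rewrite -[W x](B2_green_potential a0 Lf xa); exact: Bpos.
have zero_in : 0 \in `]- a, a[ by rewrite in_itv /= oppr_lt0 a0.
have c1pos : 0 < c1.
  have := Wcs 0 (subset_itv_oo_cc zero_in).
  rewrite mulr0 cos0 sin0 mulr1 mulr0 addr0 => <-.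
  by rewrite mulr_gt0 // Wpos.
have := Wcs _ right_in; have := Wcs _ left_in.
rewrite W_left W_right mulr0 mulrN cosN sinN mulrN => el er.
have coa : cos (q * a) = 0.
  have h : c1 * cos (q * a) = 0.
    rewrite (_ : _ * _ = ((c1 * cos (q * a) - c2 * sin (q * a)) +
      (c1 * cos (q * a) + c2 * sin (q * a))) / 2); last by field.
    by rewrite -el -er addr0 mul0r.
  by move/eqP: h; rewrite mulf_eq0 gt_eqF //= => /eqP.
have c20 : c2 = 0.
  have h : c2 * sin (q * a) = 0 by rewrite er coa mulr0 add0r.
  move/eqP: h; rewrite mulf_eq0 => /orP[/eqP //|/eqP s0].
  have := cos2Dsin2 (q * a); rewrite coa s0 !expr0n /= addr0 => /esym/eqP.
  by rewrite oner_eq0.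
have fc x : x \in `]- a, a[ -> f x = q * c1 * cos (q * x).
  move=> xa; rewrite fE // (B2_green_potential a0 Lf) // -/W expr2 -mulrA.
  by rewrite Wcs ?subset_itv_oo_cc // c20 mul0r addr0 mulrA.
split; last by exists (q * c1).
have qa : q * a = pi / 2.
  have [lt|gt|//] := ltgtP (q * a) (pi / 2).
    have : 0 < cos (q * a).
      apply: cos_gt0_pihalf; rewrite lt andbT (@lt_trans _ _ 0) ?mulr_gt0 //.
      by rewrite oppr_lt0 divr_gt0 // pi_gt0.
    by rewrite coa ltxx.
  (* If [q * a] exceeded [pi / 2], the potential would vanish at this interior point. *)
  pose y := pi / 2 / q.
  have ya : y \in `]- a, a[.
    rewrite in_itv /= ltr_pdivrMr // [a * q]mulrC gt andbT (@lt_trans _ _ 0) ?oppr_lt0 //.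
    by rewrite divr_gt0 ?divr_gt0 ?pi_gt0.
  have := Wcs y (subset_itv_oo_cc ya); rewrite c20 mul0r addr0.
  have -> : q * y = pi / 2 by rewrite /y mulrC divfK ?gt_eqF.
  rewrite cos_pihalf mulr0 => /eqP.
  by rewrite mulf_eq0 !gt_eqF // Wpos.
by apply: (mulIf (x := a)); rewrite ?gt_eqF // qa; field; rewrite gt_eqF.
Qed.

End GreenSolutions.

(** * Normalized eigenfunctions and their constants *)

Section GreenEigenfunctions.
Variable R : realType.
Notation mu := (@lebesgue_measure R).
Implicit Types (a l s x y : R) (f g h : R -> R).

Lemma Phi2_sym x y a : Phi2 x y a = Phi2 y x a.
Proof.
rewrite /Phi2; have [xy|yx|->] := ltgtP y x; last by []; by ring.
Qed.

Lemma B2adjE a f x : B2adj a f x = B2 a f x.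
Proof. by apply: eq_Rintegral => y _; rewrite Phi2_sym. Qed.

Lemma Phi2_0 x a : a != 0 -> Phi2 0 x a = (a - `|x|) / 2.
Proof.
move=> a0; rewrite /Phi2; case: ifPn => [x0|]; first by rewrite ler0_norm //; field.
by rewrite -ltNge => x0; rewrite gtr0_norm //; field.
Qed.

Lemma Phi2_gt0 a x y : 0 < a -> x \in `]- a, a[ -> y \in `]- a, a[ ->
  0 < Phi2 x y a.
Proof.
rewrite !in_itv /= => a0 /andP[x1 x2] /andP[y1 y2]; rewrite /Phi2.
by case: ifP => _; rewrite !mulr_gt0 ?invr_gt0 ?mulr_gt0 //; lra.
Qed.

Lemma measurable_L2 a f : L2 a f -> measurable_fun `]- a, a[ f.
Proof.
move=> Lf; have := L2_patch_integrable Lf.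
case/integrableP => /measurable_EFinP + _.
by move/(measurable_restrictT f); apply.
Qed.

(** The kernel is strictly positive, so a nonnegative [f] with [B2 a f x = 0] at a single point
    vanishes almost everywhere, which contradicts a nonzero inner product. *)
Lemma B2_gt0 a f g x : 0 < a -> L2 a f -> L2 a g ->
  (forall y, y \in `]- a, a[ -> 0 <= f y) -> inner a f g != 0 ->
  x \in `]- a, a[ -> 0 < B2 a f x.
Proof.
move=> a0 Lf Lg f0 fg xa.
have B0 : 0 <= B2 a f x.
  apply: Rintegral_ge0 => y /= ya; apply: mulr_ge0; last exact: f0.
  by apply/ltW/Phi2_gt0.
rewrite lt_neqAle B0 andbT eq_sym; apply: contra fg => /eqP B00.
have mI : measurable (`]- a, a[%classic : set R) by exact: measurable_itv.
have mf := measurable_L2 Lf; have mg := measurable_L2 Lg.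
have mP : measurable_fun `]- a, a[ (fun y => Phi2 x y a * f y).
  apply: measurable_funM => //; apply: measurable_funTS.
  exact: (measurableT_comp (measurable_Phi2 a) (pair1_measurable x)).
have iP : mu.-integrable `]- a, a[ (fun y => (Phi2 x y a * f y)%:E).
  have if_ : mu.-integrable `]- a, a[ (EFin \o f).
    apply/integrable_mkcond => //.
    by have := L2_patch_integrable Lf; apply: eq_integrable => // y _ /=; rewrite restrict_EFin.
  have iZ : mu.-integrable `]- a, a[ (fun y => (2 * a)%:E * (f y)%:E)%E.
    by apply: integrableZl.
  apply: (le_integrable _ _ _ iZ) => //; first exact/measurable_EFinP.
  move=> y /= ya; rewrite lee_fin !normrM ler_wpM2r // -normrM.
  by apply: le_trans (ler_norm _); exact: Phi2_bound.
have I0 : (\int[mu]_(y in [set` `]- a, a[%R]) `|(Phi2 x y a * f y)%:E| = 0)%E.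
  rewrite (_ : (\int[mu]_(y in [set` `]- a, a[%R]) _ =
      \int[mu]_(y in [set` `]- a, a[%R]) (Phi2 x y a * f y)%:E)%E).
    by rewrite -[LHS]fineK ?integrable_fin_num // -[fine _]/(B2 a f x) B00.
  apply: eq_integral => y; rewrite mem_setE => ya; congr (_%:E); rewrite ger0_norm //.
  by rewrite mulr_ge0 ?f0 // ltW // Phi2_gt0.
have mPE : measurable_fun `]- a, a[ (fun y => (Phi2 x y a * f y)%:E).
  exact/measurable_EFinP.
have f_ae0 : ae_eq mu (`]- a, a[%classic : set R) (fun y => (Phi2 x y a * f y)%:E) (cst 0%E).
  exact/ae_eq_integral_abs.
rewrite /inner /Rintegral (ae_eq_integral (cst 0%E)) //.
- by rewrite integral0.
- by apply/measurable_EFinP; exact: measurable_funM.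
- apply: filterS f_ae0 => y h ya; have := h ya => /= -[] /eqP.
  by rewrite mulf_eq0 gt_eqF ?Phi2_gt0 //= => /eqP ->; rewrite mul0r.
Qed.

Lemma continuous_integrable_oo f (a b : R) : continuous f ->
  mu.-integrable `]a, b[ (EFin \o f).
Proof.
move=> cf; have : mu.-integrable `[a, b] (EFin \o f).
  apply: continuous_compact_integrable; first exact: segment_compact.
  exact: continuous_subspaceT.
by apply: integrableS => //; exact: subset_itv_oo_cc.
Qed.

Lemma Rintegral_oo_FTC2 f F (a b : R) : a < b -> continuous f ->
  (forall x, is_derive x 1 F (f x)) -> \int[mu]_(x in `]a, b[) f x = F b - F a.
Proof.
move=> ab cf dF; have cfw : {within `[a, b], continuous f} by exact: continuous_subspaceT.
have ic : mu.-integrable `[a, b] (EFin \o f).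
  by apply: continuous_compact_integrable => //; exact: segment_compact.
have cF : continuous F.
  by move=> x; apply/differentiable_continuous/derivable1_diffP; case: (dF x).
rewrite Rintegral_itv_obnd_cbnd; last first.
  by apply: integrableS ic => //; exact: subset_itv_oo_cc.
rewrite Rintegral_itv_bndo_bndc; last first.
  by apply: integrableS ic => //; exact: subset_itv_co_cc.
rewrite /Rintegral (@continuous_FTC2 _ f F) //.
  split=> [x _||]; first by case: (dF x).
  - by apply: cvg_at_right_filter; exact: cF.
  - by apply: cvg_at_left_filter; exact: cF.
by move=> x _; rewrite derive1E; apply: derive_val.
Qed.

Let continuous_cos_scale (q : R) : continuous (fun x : R => cos (q * x)).
Proof.
move=> x; apply: (cvg_comp (fun z => q * z) (@cos R) _ (@continuous_cos R _)).
by apply: cvgMl_tmp; exact: cvg_id.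
Qed.

Let is_derive_sin_scale (q y : R) :
  is_derive y 1 (fun z : R => sin (q * z)) (cos (q * y) * q).
Proof. exact: is_derive1_comp (is_derive_sin _) (is_derive_mull q y). Qed.

Let is_derive_cos_scale (q y : R) :
  is_derive y 1 (fun z : R => cos (q * z)) (- sin (q * y) * q).
Proof. exact: is_derive1_comp (is_derive_cos _) (is_derive_mull q y). Qed.

Lemma integral_cos_sqr a : 0 < a ->
  \int[mu]_(x in `]- a, a[) (cos (pi / (2 * a) * x) ^+ 2) = a.
Proof.
move=> a0; set q := pi / (2 * a).
have q0 : 0 < q by rewrite divr_gt0 ?pi_gt0 // mulr_gt0.
have coa : cos (q * a) = 0.
  rewrite (_ : q * a = pi / 2) ?cos_pihalf //.
  by rewrite /q; field; rewrite gt_eqF.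
have aa : - a < a by apply: (@lt_trans _ _ 0); rewrite ?oppr_lt0.
have dF x : is_derive x 1 (fun x => 2^-1 * x + (2 * q)^-1 * (sin (q * x) * cos (q * x)))
    (cos (q * x) ^+ 2).
  apply: (is_derive_eq (is_deriveD (is_derive_mull 2^-1 x) (is_deriveZ (2 * q)^-1
    (is_deriveM (is_derive_sin_scale q x) (is_derive_cos_scale q x))))).
  rewrite /GRing.scale /=.
  transitivity (2^-1 + 2^-1 * (cos (q * x) ^+ 2 - sin (q * x) ^+ 2)).
    by field; rewrite gt_eqF.
  by rewrite sin2cos2; field.
rewrite (Rintegral_oo_FTC2 aa _ dF).
  by rewrite !mulrN cosN coa !mulr0 ?oppr0 !addr0; field.
by move=> x; apply: (cvg_comp _ _ (@continuous_cos_scale q x) (@exprn_continuous R _ _)).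
Qed.

Lemma integral_cos a : 0 < a ->
  \int[mu]_(x in `]- a, a[) cos (pi / (2 * a) * x) = 4 * a / pi.
Proof.
move=> a0; set q := pi / (2 * a).
have q0 : 0 < q by rewrite divr_gt0 ?pi_gt0 // mulr_gt0.
have aa : - a < a by apply: (@lt_trans _ _ 0); rewrite ?oppr_lt0.
have dF x : is_derive x 1 (fun x => q^-1 * sin (q * x)) (cos (q * x)).
  apply: (is_derive_eq (is_deriveZ q^-1 (is_derive_sin_scale q x))).
  by rewrite /GRing.scale /=; field; rewrite gt_eqF.
rewrite (Rintegral_oo_FTC2 aa _ dF); last exact: continuous_cos_scale.
rewrite mulrN sinN (_ : q * a = pi / 2) ?sin_pihalf; last first.
  by rewrite /q; field; rewrite gt_eqF.
have pi0 : pi != 0 :> R by rewrite gt_eqF // pi_gt0.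
have an0 : a != 0 by rewrite gt_eqF.
rewrite /q; move: pi0; move: (pi : R) => p p0; by field; rewrite an0 p0.
Qed.

(** By symmetry of the kernel, [g] and [h] are multiples [c] and [k] of the same cosine. The
    normalization says [c * k * a = 1], and the product sought is [c * k * (4 * a / pi)]. *)
Lemma eigenfunctions_value a l g h : 0 < a ->
  nonneg_eigenfunction a (B2 a) l g -> nonneg_eigenfunction a (B2adj a) l h ->
  inner a g h = 1 ->
  l = 4 * a ^+ 2 / pi ^+ 2 /\
  g 0 * \int[mu]_(x in `]- a, a[) h x = 4 / pi.
Proof.
move=> a0 [Lg g0 Bg] [Lh h0 Bh] gh.
have zero_in : 0 \in `]- a, a[ by rewrite in_itv /= oppr_lt0 a0.
have hg : inner a h g = 1 by rewrite -gh; apply: eq_Rintegral => x _; rewrite mulrC.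
have posg x : x \in `]- a, a[ -> 0 < B2 a g x.
  by apply: (B2_gt0 a0 Lg Lh g0); rewrite gh oner_eq0.
have posh x : x \in `]- a, a[ -> 0 < B2 a h x.
  by apply: (B2_gt0 a0 Lh Lg h0); rewrite hg oner_eq0.
have l0 : 0 < l.
  have := posg 0 zero_in; rewrite Bg // => lg0; rewrite ltNge; apply/negP => l0.
  by have := mulr_le0_ge0 l0 (g0 0 zero_in); rewrite leNgt lg0.
(* With this [q], the eigenvalue equation reads [g = q ^+ 2 * B2 a g]. *)
pose q := (Num.sqrt l)^-1.
have sl0 : 0 < Num.sqrt l by rewrite sqrtr_gt0.
have q0 : 0 < q by rewrite invr_gt0.
have q2 : q ^+ 2 = l^-1 by rewrite exprVn sqr_sqrtr // ltW.
have [|qE [c gc]] := green_positive_solution a0 Lg q0 posg.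
  by move=> x xa; rewrite q2 Bg // mulKf // gt_eqF.
have [|_ [k hk]] := green_positive_solution a0 Lh q0 posh.
  by move=> x xa; rewrite q2 -B2adjE Bh // mulKf // gt_eqF.
have pi0 : pi != 0 :> R by rewrite gt_eqF // pi_gt0.
split.
  have -> : l = (q ^+ 2)^-1 by rewrite q2 invrK.
  have an0 : a != 0 by rewrite gt_eqF.
  by rewrite qE; move: pi0; move: (pi : R) => p p0; field; rewrite an0 p0.
have Ekc : \int[mu]_(x in `]- a, a[) h x = k * (4 * a / pi).
  rewrite -integral_cos // -qE -RintegralZl //.
    by apply: eq_Rintegral => x; rewrite mem_setE; exact: hk.
  by apply: continuous_integrable_oo; exact: continuous_cos_scale.
have ckE : c * k * a = 1.
  rewrite -gh -[X in c * k * X](integral_cos_sqr a0) -qE -RintegralZl //.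
    apply: eq_Rintegral => x; rewrite mem_setE => xa; rewrite gc // hk //; ring.
  apply: continuous_integrable_oo => x.
  exact: (cvg_comp _ _ (@continuous_cos_scale q x) (@exprn_continuous R _ _)).
rewrite gc // mulr0 cos0 mulr1 Ekc.
have -> : 4 / pi = c * k * a * (4 / pi) by rewrite ckE mul1r.
by ring.
Qed.

End GreenEigenfunctions.

(** * Scaling of the resolvent *)

Section ResolventScaling.
Variable R : realType.
Implicit Types (a s x y : R) (f u : R -> R).

Lemma within_segment_scale f a : 0 < a -> {within `[- a, a], continuous f} ->
  {within `[-1, 1], continuous (fun x => f (a * x))}.
Proof.
move=> a0 /subspace_continuousP cf; apply/subspace_continuousP => x x1.
have sc y : `[-1, 1]%classic y -> `[- a, a]%classic (a * y).
  rewrite /= !in_itv /= => /andP[h1 h2].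
  by rewrite -mulrN1 !ler_pM2l // h1 /= ler_piMr // ltW.
apply: (cvg_comp _ f _ (cf _ (sc x x1))) => B.
rewrite /within => nB.
have ca : {for x, continuous (fun y : R => a * y)}.
  by apply: cvgMl_tmp; exact: cvg_id.
suff : nbhs x (fun y => `[-1, 1]%classic y -> B (a * y)) by [].
have : nbhs x (fun y => `[- a, a]%classic (a * y) -> B (a * y)) by exact: (ca _ nB).
by apply: filterS => y h y1; apply: h; exact: sc.
Qed.

Lemma Phi2_0_scale a x : 0 < a -> Phi2 0 (a * x) a = a * Phi2 0 x 1.
Proof.
move=> a0; rewrite !Phi2_0 ?gt_eqF // normrM (gtr0_norm a0).
by field.
Qed.

Lemma resolvent_green a s u : 0 < a ->
  is_resolvent a s (B2adj a) (fun x => Phi2 0 x a) u ->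
  (forall x, x \in `]- a, a[ -> u x = Phi2 0 x a - s * green_potential a u x) /\
  (forall x, x \in `]- a, a[ ->
    is_derive x 1 (green_potential a u) (green_slope a u x) /\
    is_derive x 1 (green_slope a u) (- u x)).
Proof.
move=> a0 [Lu uE].
have uB x : x \in `]- a, a[ -> u x = Phi2 0 x a + (- s) * B2 a u x.
  by move=> xa; rewrite -uE // B2adjE; ring.
split=> x xa; first by rewrite uB // (B2_green_potential a0 Lu) // mulNr.
apply: (green_ode a0 Lu xa).
apply: (green_continuous a0 Lu (k := fun x => (a - `|x|) / 2) (kappa := - s)) => //.
  move=> y; apply: cvgMr_tmp; apply: cvgB; first exact: cvg_cst.
  by apply: cvg_norm; exact: cvg_id.
by move=> y ya; rewrite uB // Phi2_0 // gt_eqF.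
Qed.

(* The difference of the two rescaled potentials solves [W'' = s a ^ 2 W] with
   zero boundary values; no change of variables in the integrals is needed. *)
Lemma resolvent_scale a s ua u1 x : 0 < a -> 0 < s ->
  is_resolvent a s (B2adj a) (fun x => Phi2 0 x a) ua ->
  is_resolvent 1 (s * a ^+ 2) (B2adj 1) (fun x => Phi2 0 x 1) u1 ->
  x \in `]-1, 1[ -> ua (a * x) = a * u1 x.
Proof.
move=> a0 s0 ra r1 x1.
have [uaE dua] := resolvent_green a0 ra; have [u1E du1] := resolvent_green ltr01 r1.
have La := proj1 ra; have L1 := proj1 r1.
have sc y : y \in `]-1, 1[ -> a * y \in `]- a, a[.
  rewrite !in_itv /= => /andP[h1 h2].
  by rewrite -mulrN1 !ltr_pM2l // h1 /= gtr_pMr.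
(* If [ua (a * y) = a * u1 y], integrating twice in the stretched variable adds a factor [a ^+ 2];
   hence the cube. *)
pose W y := green_potential a ua (a * y) - a ^+ 3 * green_potential 1 u1 y.
pose V y := a * green_slope a ua (a * y) - a ^+ 3 * green_slope 1 u1 y.
have W0 : W x = 0.
  apply: (@hyperbolic_unique _ W V 1 (Num.sqrt s * a)).
  - exact: ltr01.
  - by rewrite mulr_gt0 // sqrtr_gt0.
  - move=> y; apply: cvgB.
      exact: (within_segment_scale a0 (green_potential_continuous a0 La)).
    by apply: cvgMl_tmp; exact: (green_potential_continuous ltr01 L1).
  - move=> y; apply: cvgB; apply: cvgMl_tmp.
      exact: (within_segment_scale a0 (green_slope_continuous a0 La)).
    exact: (green_slope_continuous ltr01 L1).
  - by rewrite /W mulrN1 !green_potential_left mulr0 subr0.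
  - by rewrite /W mulr1 (green_potential_right a0 La) (green_potential_right ltr01 L1) mulr0 subr0.
  - move=> y y1; have [dWa dVa] := dua _ (sc y y1); have [dW1 dV1] := du1 _ y1.
    split.
      apply: (is_derive_eq (is_deriveB (is_derive1_comp dWa (is_derive_mull a y))
        (is_deriveZ (a ^+ 3) dW1))).
      by rewrite /V /GRing.scale /=; ring.
    apply: (is_derive_eq (is_deriveB (is_deriveZ a (is_derive1_comp dVa (is_derive_mull a y)))
        (is_deriveZ (a ^+ 3) dV1))).
    (* The Green function terms cancel by [Phi2_0_scale], which leaves the homogeneous equation. *)
    rewrite /GRing.scale /= uaE ?sc // u1E // Phi2_0_scale // /W exprMn sqr_sqrtr ?(ltW s0) //.
    by ring.
  - exact: subset_itv_oo_cc x1.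
rewrite uaE ?sc // u1E // Phi2_0_scale //.
move/eqP: W0; rewrite subr_eq0 => /eqP ->; ring.
Qed.

End ResolventScaling.

(** * Scaling and limits of the exit probability *)

Section ExitAsymptotics.
Context (d : measure_display) (T : measurableType d) (R : realType)
        (P : probability T R) (X : R -> T -> R).
Hypothesis hX : wiener_process P X.

Let rate (u : R) := u * (pi / 2) ^+ 2.

Let rate_gt0 u : 0 < u -> 0 < rate u.
Proof. by move=> u0; rewrite mulr_gt0 // exprn_gt0 // divr_gt0 // pi_gt0. Qed.

Let pi4 : 0 < pi / 4 :> R.
Proof. by rewrite divr_gt0 // pi_gt0. Qed.

Lemma exit_tail_cvg0 (v : R) : 0 < v -> exit_tail N v @[N --> \oo] --> (0 : R).
Proof.
move=> v0; rewrite -[X in _ --> X](mul0r (1 - expR (- (8 * v)))^-1).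
apply: cvgMr_tmp.
apply: cvg_geometric; rewrite ger0_norm ?expR_ge0 //.
by rewrite expR_lt1 oppr_lt0 mulr_gt0.
Qed.

(** Both sides are approximated by the same partial sum, as the bound involves time and level only
    through [t / a ^+ 2]; the tails tend to 0. *)
Lemma p2_scale t a : 0 < t -> 0 < a -> p2 P X t a = p2 P X (t / a ^+ 2) 1.
Proof.
move=> t0 a0; have u0 : 0 < t / a ^+ 2 by rewrite divr_gt0 // exprn_gt0.
apply: (mulfI (lt0r_neq0 pi4)); apply/eqP; rewrite -subr_eq0 -normr_le0.
have c0 : exit_tail N (rate (t / a ^+ 2)) + exit_tail N (rate (t / a ^+ 2))
    @[N --> \oo] --> (0 : R).
  by rewrite -[X in _ --> X](addr0 0); apply: cvgD; exact/exit_tail_cvg0/rate_gt0.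
apply: (cvgr_to_ge c0); apply: nearW => N.
have h1 := p2_bound hX N t0 a0; have := p2_bound hX N u0 ltr01.
rewrite expr1n divr1 distrC => h2.
apply: le_trans (ler_distD (exit_sum 1 N (rate (t / a ^+ 2))) _ _) _.
exact: lerD.
Qed.

Lemma p2_asymptotics (a : R -> R) : (forall t, 0 < t -> 0 < a t) ->
  t / a t ^+ 2 @[t --> +oo] --> +oo ->
  exists2 e : R -> R, e t @[t --> +oo] --> (0 : R) &
    forall t, 0 < t ->
      p2 P X t (a t) = expR (- rate (t / a t ^+ 2)) * (4 / pi) * (1 + e t).
Proof.
move=> a0 ua.
pose v t := rate (t / a t ^+ 2).
exists (fun t => pi / 4 * p2 P X t (a t) / expR (- v t) - 1); last first.
  move=> t t0; rewrite addrC subrK; have pi0 : pi != 0 :> R by rewrite gt_eqF // pi_gt0.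
  have := expR_gt0 (- v t); rewrite /v; set E := expR _ => E0.
  move: (pi : R) pi0 => p p0; field; rewrite p0 gt_eqF //.
have c8 : expR (- (8 * v t)) @[t --> +oo] --> (0 : R).
  apply: (cvg_comp (fun t => 8 * v t) (fun x => expR (- x)) _ (@cvgr_expR R)).
  by apply: gt0_cvgMry => //; apply: gt0_cvgMly => //; rewrite exprn_gt0 // divr_gt0 // pi_gt0.
have c : expR (- (8 * v t)) / (1 - expR (- (8 * v t))) @[t --> +oo] --> (0 : R).
  rewrite -[X in _ --> X](mul0r (1 - 0)^-1); apply: cvgM => //.
  apply: cvgV; first by rewrite subr0 oner_eq0.
  by apply: cvgB => //; exact: cvg_cst.
apply/norm_cvg0P; apply: (squeeze_cvgr _ (cvg_cst 0) c).
near=> t; rewrite normr_ge0 /=.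
have t0 : 0 < t by [].
have E0 : 0 < expR (- v t) := expR_gt0 _.
(* Order 1 keeps a single term, equal to [expR (- v t)]. *)
have := p2_bound hX 1 t0 (a0 t t0); rewrite -/(rate _) -/(v t).
rewrite /exit_sum big_ord1 /exit_term /exit_tail /= !expr1 !expr1n !expr0 divr1 !mul1r.
move=> h; rewrite -(ler_pM2l E0) -[X in X * `|_|](gtr0_norm E0) -normrM mulrBr mulr1.
by rewrite mulrCA divff ?gt_eqF // mulr1 mulrA.
Unshelve. all: end_near. Qed.

Lemma p2_cvg0 (a : R -> R) : (forall t, 0 < t -> 0 < a t) ->
  t / a t ^+ 2 @[t --> +oo] --> +oo -> p2 P X t (a t) @[t --> +oo] --> (0 : R).
Proof.
move=> a0 ua; have [e e0 pE] := p2_asymptotics a0 ua.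
have cE : expR (- rate (t / a t ^+ 2)) * (4 / pi) * (1 + e t) @[t --> +oo] -->
    (0 : R) * (4 / pi) * (1 + 0).
  apply: cvgM; last by apply: cvgD => //; exact: cvg_cst.
  apply: cvgMr_tmp.
  apply: (cvg_comp (fun t => rate (t / a t ^+ 2)) (fun x => expR (- x)) _ (@cvgr_expR R)).
  by apply: gt0_cvgMly => //; rewrite exprn_gt0 // divr_gt0 // pi_gt0.
move: cE; rewrite !mul0r; apply: cvg_trans; apply: near_eq_cvg.
near=> t; rewrite pE //.
Unshelve. all: end_near. Qed.

(** Values at [u] and [x] are compared through one partial sum: [N] makes the tail small at [u], and
    continuity of [exit_tail] keeps it small near [u]. *)
Lemma p2_continuous (u : R) : 0 < u -> {for u, continuous (p2 P X ^~ 1)}.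
Proof.
move=> u0; apply/cvgrPdist_lt => e e0.
have e40 : 0 < pi / 4 * (e / 3) by rewrite mulr_gt0 // divr_gt0.
have [N hN] : exists N, exit_tail N (rate u) < pi / 4 * (e / 3).
  have /cvgrPdist_lt /(_ _ e40) [N _ /(_ N (leqnn _))] := exit_tail_cvg0 (rate_gt0 u0).
  rewrite sub0r normrN => h; exists N; exact: le_lt_trans (ler_norm _) h.
have cr : rate x @[x --> u] --> rate u by apply: cvgMr_tmp; exact: cvg_id.
have c1 : `|exit_sum 1 N (rate u) - exit_sum 1 N (rate x)| + exit_tail N (rate x)
    @[x --> u] --> 0 + exit_tail N (rate u).
  apply: cvgD; last exact: (cvg_comp _ _ cr (@exit_tail_continuous _ N _ (rate_gt0 u0))).
  have cs := cvg_comp _ _ cr (@exit_sum_continuous R N (rate u)).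
  by have := cvg_norm (cvgB (cvg_cst (exit_sum 1 N (rate u))) cs); rewrite subrr normr0; apply.
rewrite add0r in c1.
have nx := cvgr_gt _ cr _ (rate_gt0 u0).
have nc := cvgr_lt _ c1 _ hN.
near=> x.
have x0 : 0 < x.
  have : 0 < rate x by near: x; exact: nx.
  by rewrite pmulr_lgt0 // exprn_gt0 // divr_gt0 // pi_gt0.
have hx : `|exit_sum 1 N (rate u) - exit_sum 1 N (rate x)| + exit_tail N (rate x) <
    pi / 4 * (e / 3) by near: x; exact: nc.
have := p2_bound hX N u0 ltr01; have := p2_bound hX N x0 ltr01.
rewrite !expr1n !divr1 => h1 h2.
have : `|pi / 4 * p2 P X u 1 - pi / 4 * p2 P X x 1| < pi / 4 * e.
  have d1 := ler_distD (exit_sum 1 N (rate u)) (pi / 4 * p2 P X u 1) (pi / 4 * p2 P X x 1).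
  have d2 := ler_distD (exit_sum 1 N (rate x)) (exit_sum 1 N (rate u)) (pi / 4 * p2 P X x 1).
  rewrite distrC in h1; rewrite -/(rate x) -/(rate u) in h1 h2.
  move: d1 d2 h1 h2 hN hx; lra.
by rewrite -mulrBr normrM (gtr0_norm pi4) ltr_pM2l.
Unshelve. all: end_near. Qed.

Lemma p2_ge0 t a : 0 <= p2 P X t a.
Proof. by rewrite fine_ge0. Qed.

Lemma p2_le1 t a : 0 < t -> 0 < a -> p2 P X t a <= 1.
Proof.
move=> t0 a0; rewrite -lee_fin fineK_probability ?probability_le1 //;
  exact: (measurable_running_sup_lt hX).
Qed.

Lemma p2_nonincreasing s t a : 0 < s -> s <= t -> 0 < a -> p2 P X t a <= p2 P X s a.
Proof.
move=> s0 st a0; have t0 := lt_le_trans s0 st.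
have ms := measurable_running_sup_lt hX s0 a0.
have mt := measurable_running_sup_lt hX t0 a0.
rewrite -lee_fin !fineK_probability //; apply: le_measure; rewrite ?inE //.
move=> w /=; apply: le_lt_trans; apply: ereal_sup_le => _ [tau /= taus <-].
exists tau => //=; move: taus; rewrite !in_itv /= => /andP[-> h].
exact: le_trans st.
Qed.

Lemma measurable_lt_running_sup t a : 0 < t -> 0 < a ->
  measurable [set w | (a%:E < running_sup X t w)%E].
Proof.
move=> t0 a0.
rewrite (_ : [set w | _] = ~` (\bigcap_n
    [set w | (running_sup X t w < (a + n.+1%:R^-1)%:E)%E])); last first.
  apply/seteqP; split=> w /=.
    move=> lt h; move: lt; rewrite ltNge => /negP; apply.
    apply/lee_addgt0Pr => e e0.
    have /cvgrPdist_lt /(_ e e0) [n _ /(_ n (leqnn _))] := @cvg_harmonic R.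
    rewrite sub0r normrN ger0_norm //= => hn.
    apply/ltW/(lt_trans (h n I)); rewrite -EFinD lte_fin ltrD2l.
    exact: hn.
  move=> h; rewrite ltNge; apply/negP => le; apply: h => n _ /=.
  by apply: le_lt_trans le _; rewrite lte_fin ltrDl invr_gt0.
apply: measurableC; apply: bigcapT_measurable => n.
by apply: (measurable_running_sup_lt hX) => //; rewrite addr_gt0 // invr_gt0.
Qed.

(** The event [a < running_sup] and the complement of [running_sup < a] differ by equality; the
    level [2 * a] gives a lower bound that avoids the probability of equality. *)
Lemma prob_sup_gt_bounds t a : 0 < t -> 0 < a ->
  1 - p2 P X t (2 * a) <= prob_sup_gt P X t a <= 1 - p2 P X t a.
Proof.
move=> t0 a0; have a20 : 0 < 2 * a by rewrite mulr_gt0.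
have compl b : 0 < b -> ((1 - p2 P X t b)%:E =
    P (~` [set w | (running_sup X t w < b%:E)%E]))%E.
  move=> b0; have mb := measurable_running_sup_lt hX t0 b0.
  by rewrite probability_setC // -(fineK_probability P mb).
have ma := measurable_running_sup_lt hX t0 a0.
have ma2 := measurable_running_sup_lt hX t0 a20.
have mg := measurable_lt_running_sup t0 a0.
rewrite -!lee_fin !compl // fineK_probability //; apply/andP; split.
  apply: le_measure; rewrite ?inE //; first exact: measurableC.
  move=> w /= /negP; rewrite -leNgt; apply: lt_le_trans.
  by rewrite lte_fin; move: a0; lra.
apply: le_measure; rewrite ?inE //; first exact: measurableC.
by move=> w /= h; apply/negP; rewrite -leNgt ltW.
Qed.

(** The tail bound blows up as the exponent tends to 0, so path continuity takes over: a path
    starting at 0 stays below [1 / 2] for some time, and the increasing events [F n] cover the full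
    set [X 0 = 0]. *)
Lemma p2_small_cvg1 : p2 P X n.+1%:R^-1 1 @[n --> \oo] --> (1 : R).
Proof.
pose F n := [set w | (running_sup X n.+1%:R^-1 w < (1 : R)%:E)%E].
have mF n : measurable (F n) by exact: (measurable_running_sup_lt hX).
have mU : measurable (\bigcup_n F n) by exact: bigcup_measurable.
have U1 : P (\bigcup_n F n) = 1%E.
  have : P (~` (\bigcup_n F n)) = 0%E.
    apply/eqP; rewrite eq_le measure_ge0 andbT -(start_full hX).
    apply: le_measure; rewrite ?inE; [exact: measurableC|..].
      exact/measurableC/(measurable_start hX).
    apply: subsetC => w /= w0.
    have cX : {within `[0, 1], continuous (X ^~ w)}.
      apply: continuous_subspaceW (@wiener_continuous _ _ _ _ _ hX w).
      by move=> x /=; rewrite !in_itv /= => /andP[-> _].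
    have e0 : 0 < 2^-1 :> R by rewrite invr_gt0.
    have [r r0 hr] := within_segment_unif_continuous cX e0.
    have /cvgrPdist_lt /(_ r r0) [n _ /(_ n (leqnn _))] := @cvg_harmonic R.
    rewrite sub0r normrN ger0_norm //= => hn; exists n => //=.
    apply: (@le_lt_trans _ _ (2^-1 : R)%:E); last by rewrite lte_fin invf_lt1 // ltr1n.
    apply/running_sup_le => tau /andP[tau0 taun].
    have n1 : n.+1%:R^-1 <= 1 :> R by rewrite invf_le1 // ler1n.
    have := hr tau 0; rewrite !in_itv /= tau0 (le_trans taun n1) lexx ler01 subr0.
    move=> /(_ isT isT); rewrite w0 subr0 ger0_norm // => h.
    exact/ltW/h/(le_lt_trans taun).
  rewrite probability_setC // => /eqP; rewrite sube_eq ?fin_num_measure // add0e.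
  by move=> /eqP ->.
have c : P (F n) @[n --> \oo] --> P (\bigcup_n F n).
  apply: nondecreasing_cvg_mu => // m n mn; apply/subsetPset => w /=.
  apply: le_lt_trans; apply: ereal_sup_le => _ [tau /= taus <-]; exists tau => //=.
  move: taus; rewrite !in_itv /= => /andP[-> h]; apply: le_trans h _.
  by rewrite lef_pV2 ?posrE // ler_nat ltnS.
by rewrite U1 in c; apply: fine_cvg; exact: c.
Qed.

End ExitAsymptotics.

Unset Implicit Arguments.

Theorem proposition4p1 (R : realType) (d : measure_display)
  (T : measurableType d) (P : probability T R) (X : R -> T -> R)
  (lambda2 : R -> R) (g2 h2 : R -> R -> R) (psi2 : R -> R -> R -> R)
  (hX : wiener_process P X)
  (hlambda : forall a : R, 0 < a -> largest_eigenvalue a (B2 a) (lambda2 a))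
  (hg : forall a : R, 0 < a ->
     nonneg_eigenfunction a (B2 a) (lambda2 a) (g2 ^~ a))
  (hh : forall a : R, 0 < a ->
     nonneg_eigenfunction a (B2adj a) (lambda2 a) (h2 ^~ a))
  (hgh : forall a : R, 0 < a -> inner a (g2 ^~ a) (h2 ^~ a) = 1)
  (hpsi : forall s a : R, 0 < s -> 0 < a ->
     is_resolvent a s (B2adj a) (fun x => Phi2 0 x a) (fun x => psi2 x s a)) :
  [/\ (* (A) *)
      forall a : R, 0 < a ->
        exists2 e : R -> R, e t @[t --> +oo] --> (0 : R) &
        \forall t \near +oo,
          p2 P X t a =
          expR (- (t / lambda2 a)) * g2 0 a *
          (\int[lebesgue_measure]_(x in `]- a, a[) h2 x a) * (1 + e t),
      (* (B) *)
      forall a s t x : R, 0 < a -> 0 < s -> 0 < t -> -1 < x < 1 ->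
        psi2 (a * x) s a = a * psi2 x (s * a ^+ 2) 1 /\
        p2 P X t a = p2 P X (t / a ^+ 2) 1,
      (* (C) *)
      forall a : R -> R, (forall t : R, 0 < t -> 0 < a t) ->
        t / (a t) ^+ 2 @[t --> +oo] --> +oo ->
        [/\ exists2 e : R -> R, e t @[t --> +oo] --> (0 : R) &
            \forall t \near +oo,
              p2 P X t (a t) =
              expR (- (t / ((a t) ^+ 2 * lambda2 1))) * g2 0 1 *
              (\int[lebesgue_measure]_(x in `](-1), 1[) h2 x 1) * (1 + e t),
            p2 P X t (a t) @[t --> +oo] --> (0 : R) &
            prob_sup_gt P X t (a t) @[t --> +oo] --> (1 : R)],
      (* (D) *)
      forall a : R -> R, (forall t : R, 0 < t -> 0 < a t) ->
        t / (a t) ^+ 2 @[t --> +oo] --> (0 : R) ->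
        p2 P X t (a t) @[t --> +oo] --> (1 : R) /\
        prob_sup_gt P X t (a t) @[t --> +oo] --> (0 : R) &
      (* (E) *)
      forall (a : R -> R) (T0 : R), (forall t : R, 0 < t -> 0 < a t) ->
        0 < T0 ->
        t / (a t) ^+ 2 @[t --> +oo] --> T0 ->
        p2 P X t (a t) @[t --> +oo] --> p2 P X T0 1].
Proof.
have eig (a : R) (a0 : 0 < a) := eigenfunctions_value a0 (hg a a0) (hh a a0) (hgh a a0).
split.
- move=> a a0; have [lE ghE] := eig a a0.
  have ua : t / a ^+ 2 @[t --> +oo] --> +oo.
    by apply: gt0_cvgMly; [rewrite invr_gt0 exprn_gt0|exact: cvg_id].
  have [e e0 pE] := p2_asymptotics hX (a := fun=> a) (fun _ _ => a0) ua.
  exists e => //; exists 0; split => // t t0; rewrite pE //.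
  rewrite -[_ * g2 0 a * _]mulrA ghE lE; congr (expR (- _) * _ * _).
  have pi0 : pi != 0 :> R by rewrite gt_eqF // pi_gt0.
  have an0 : a != 0 by rewrite gt_eqF.
  by move: (pi : R) pi0 => p p0; field; rewrite an0 p0.
- move=> a s t x a0 s0 t0 x1; split; last exact: (p2_scale hX).
  have s20 : 0 < s * a ^+ 2 by rewrite mulr_gt0 // exprn_gt0.
  apply: (resolvent_scale a0 s0 (hpsi s a s0 a0) (hpsi _ 1 s20 ltr01)).
  by rewrite in_itv.
- move=> a a0 ua; have [lE ghE] := eig 1 ltr01.
  have pi0 : pi != 0 :> R by rewrite gt_eqF // pi_gt0.
  split.
  + have [e e0 pE] := p2_asymptotics hX a0 ua.
    exists e => //; exists 0; split => // t t0; rewrite pE //.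
    rewrite -[_ * g2 0 1 * _]mulrA ghE lE; congr (expR (- _) * _ * _).
    have an0 : a t != 0 by rewrite gt_eqF // a0.
    by move: (pi : R) pi0 => p p0; field; rewrite an0 p0.
  + exact: (p2_cvg0 hX).
  (* Doubling the level only divides the ratio by 4, so the lower side of the sandwich also tends to
     1. *)
  + have a20 t : 0 < t -> 0 < 2 * a t by move=> t0; rewrite mulr_gt0 // a0.
    have ua2 : t / (2 * a t) ^+ 2 @[t --> +oo] --> +oo.
      under eq_fun do rewrite exprMn invfM mulrCA mulrC.
      by apply: gt0_cvgMly; rewrite // invr_gt0 exprn_gt0.
    have c : 1 - p2 P X t (2 * a t) @[t --> +oo] --> 1 - (0 : R).
      by apply: cvgB; [exact: cvg_cst|exact: (p2_cvg0 hX a20 ua2)].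
    rewrite subr0 in c.
    apply: (squeeze_cvgr _ c (cvg_cst (1 : R))); exists 0; split => // t t0.
    have /andP[-> /le_trans] := prob_sup_gt_bounds hX t0 (a0 t t0).
    by apply; rewrite gerBl p2_ge0.
- move=> a a0 ua.
  have cp : p2 P X t (a t) @[t --> +oo] --> (1 : R).
    apply/cvgrPdist_le => e e0.
    (* At level 1, time [n.+1%:R^-1] is already within [e] of the limit; scaling and monotonicity in
       time extend this to every smaller ratio. *)
    have /cvgrPdist_le /(_ e e0) [n _ /(_ n (leqnn _))] := p2_small_cvg1 hX.
    have p1 u : 0 < u -> p2 P X u 1 <= 1 by move=> u0; exact: (p2_le1 hX).
    rewrite ger0_norm ?subr_ge0 ?p1 ?invr_gt0 // => hn.
    have n0 : 0 < n.+1%:R^-1 :> R by rewrite invr_gt0.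
    have nu := cvgr_lt _ ua _ n0.
    near=> t.
    have t0 : 0 < t by [].
    have u0 : 0 < t / a t ^+ 2 by rewrite divr_gt0 // exprn_gt0 // a0.
    rewrite (p2_scale hX) ?a0 // ger0_norm ?subr_ge0 ?p1 // (le_trans _ hn) //.
    rewrite lerD2l lerN2; apply: (p2_nonincreasing hX) => //; apply: ltW.
    by near: t; exact: nu.
  split=> //; have c : 1 - p2 P X t (a t) @[t --> +oo] --> 1 - (1 : R).
    by apply: cvgB => //; exact: cvg_cst.
  rewrite subrr in c; apply: (squeeze_cvgr _ (cvg_cst (0 : R)) c); exists 0; split => // t t0.
  have /andP[h ->] := prob_sup_gt_bounds hX t0 (a0 t t0).
  by rewrite andbT fine_ge0.
- move=> a T0 a0 T00 ua.
  have := cvg_comp _ _ ua (p2_continuous hX T00); apply: cvg_trans.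
  apply: near_eq_cvg; exists 0; split => // t t0 /=.
  by rewrite -(p2_scale hX) // a0.
Unshelve. all: end_near. Qed.
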